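(* (i) Let $G$ be a connected graph on $n\ge 2$ vertices and let $\ell$ denote the maximum length of a path in $G$. Then $$\mathrm{lpt}(G)\le \min\{\sqrt{8n},\,33\cdot \ell^{5/9}\}.$$ (ii) For every $2$-connected graph $G$ on $n$ vertices, we have $\mathrm{lct}(G)\le \sqrt{8n}$.
   Context: All graphs are finite, simple and undirected. The length of a path or cycle is its number of edges. A longest path (longest cycle) of $G$ is a path (cycle) in $G$ attaining the maximum length among all paths (cycles) in $G$. $\mathrm{lpt}(G)$ denotes the minimum size of a longest path transversal of $G$, i.e. of a set $S\subseteq V(G)$ such that every longest path in $G$ contains at least one vertex of $S$. $\mathrm{lct}(G)$ denotes the minimum size of a longest cycle transversal of $G$, i.e. of a set $S\subseteq V(G)$ such that every longest cycle in $G$ contains at least one vertex of $S$. A $2$-connected graph has at least $3$ vertices and remains connected after deleting any single vertex. *)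

(* Defs.v *)
From HB Require Import structures.
From mathcomp Require Import all_boot.
From mathcomp Require Import boolp.

Set Implicit Arguments.
Unset Strict Implicit.
Unset Printing Implicit Defensive.

Record sgraph := SGraph {
  vertex :> finType;
  edge : rel vertex;
  edge_sym : symmetric edge;
  edge_irrefl : irreflexive edge }.

Definition sg_connected (G : sgraph) : Prop :=
  forall x y : G, connect (@edge G) x y.

Section DeleteVertex.
Variables (G : sgraph) (v : G).

Definition del_edge : rel {x : G | x != v} :=
  fun x y => edge (val x) (val y).

Lemma del_edge_sym : symmetric del_edge.
Proof. by move=> x y; exact: edge_sym. Qed.

Lemma del_edge_irrefl : irreflexive del_edge.
Proof. by move=> x; exact: edge_irrefl. Qed.

Definition del_vertex : sgraph := SGraph del_edge_sym del_edge_irrefl.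

End DeleteVertex.

Definition two_connected (G : sgraph) : Prop :=
  [/\ 3 <= #|G|, sg_connected G & forall v : G, sg_connected (del_vertex v)].

(* A path is given by the sequence of its vertices in order, so each path of
   positive length is represented twice (once per orientation). *)
Definition is_path (G : sgraph) (s : seq G) : bool :=
  [&& s != [::], sorted (@edge G) s & uniq s].

Definition path_length (G : sgraph) (s : seq G) : nat := (size s).-1.

Definition longest_path (G : sgraph) (s : seq G) : Prop :=
  is_path s /\ forall t : seq G, is_path t -> path_length t <= path_length s.

Definition is_max_path_length (G : sgraph) (l : nat) : Prop :=
  exists2 s : seq G, longest_path s & path_length s = l.

(* A cycle is given by its cyclic sequence of vertices, without repeating the
   first one at the end.  The size condition is needed because MathComp's
   [cycle] also accepts [::] and, for an edge xy, the sequence [:: x; y]. *)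
Definition is_cycle (G : sgraph) (c : seq G) : bool :=
  [&& 3 <= size c, cycle (@edge G) c & uniq c].

Definition cycle_length (G : sgraph) (c : seq G) : nat := size c.

Definition longest_cycle (G : sgraph) (c : seq G) : Prop :=
  is_cycle c /\ forall d : seq G, is_cycle d -> cycle_length d <= cycle_length c.

Definition longest_path_transversal (G : sgraph) (S : {set G}) : Prop :=
  forall s : seq G, longest_path s -> exists2 x, x \in S & x \in s.

Definition longest_cycle_transversal (G : sgraph) (S : {set G}) : Prop :=
  forall c : seq G, longest_cycle c -> exists2 x, x \in S & x \in c.

(* [arg min] needs a witness satisfying the condition: paths and cycles are
   nonempty, so the whole vertex set is always a transversal. *)
Definition lpt (G : sgraph) : nat :=
  #|[arg min_(S < [set: G] | `[< longest_path_transversal S >]) #|S|]|.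

Definition lct (G : sgraph) : nat :=
  #|[arg min_(S < [set: G] | `[< longest_cycle_transversal S >]) #|S|]|.

(* Main.v *)
(** A family of longest paths (or cycles) is intersecting, and each member Q is
    rigid: a detour of Q is never longer than the piece of Q it replaces.  For a
    vertex set W let tv W be the least size of a set hitting every member that
    touches W, and let k be the transversal number.  By Menger's theorem, two
    sets with tv at least m are joined by m disjoint paths.  If a cycle O misses a
    member Q, then tv O disjoint O-Q paths attach at vertices of Q which, by
    rigidity, are pairwise at distance at least |O|/2 + 2; hence tv O * |O| is
    O(|Q|), and a cycle with larger tv is hit by every member.

    For 8n >= k^2: otherwise every cycle with tv >= k/2 is hit by every member, so
    a shortest such cycle O is isometric (a shortcut would split it into two
    shorter cycles, one of which still has tv >= k/2).  Cutting O into two arcs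
    joined by k/2 disjoint paths, each at least as long as the distance in O
    between its ends, gives about k^2/8 vertices.

    For the other bound one even gets k^2 <= 1089 l.  Otherwise every cycle with
    tv >= k/20 + 1 is hit by every member.  About k/288 disjoint paths between two
    pieces of a longest path, closed up along that path, give disjoint such cycles
    with at least 0.84 k vertices per path used.  Two of them can be merged by
    two of the k disjoint paths joining one to the others, losing only a small
    fraction of the vertices, so that a single cycle made of n of the paths keeps
    at least 0.84 k (n + sqrt n) / 2 vertices.  The last one is longer than l. *)
Require Import Defs.
From mathcomp Require Import all_boot all_order all_algebra.
From mathcomp Require Import reals exp boolp zify lra.

Set Implicit Arguments.
Unset Strict Implicit.
Unset Printing Implicit Defensive.

(* [lia] does not identify [size] taken at the two convertible carriers of a
   finite type, so sizes are generalized first. *)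
Ltac size_lia := clear;
  repeat match goal with |- context [@size _ ?s] => move: (size s) => ? end; lia.

(** * Menger's theorem *)

Section Menger.
Variable T : finType.
Implicit Types (r : rel T) (A B S : {set T}) (l : T * seq T).

(* The pair (x, p) stands for the path with vertex sequence x :: p. *)
Definition verts l := l.1 :: l.2.
Definition lend l := last l.1 l.2.
Arguments verts : simpl never.
Arguments lend : simpl never.

Definition link r A B l :=
  [&& l.1 \in A, lend l \in B, path r l.1 l.2 & uniq (verts l)].

Definition tight A B l :=
  (forall z, z \in verts l -> z \in A -> z = l.1) /\
  (forall z, z \in verts l -> z \in B -> z = lend l).

Definition disj (ls : seq (T * seq T)) := uniq (flatten (map verts ls)).

Lemma lend_verts l : lend l \in verts l.
Proof. exact: mem_last. Qed.

Lemma fst_verts l : l.1 \in verts l.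
Proof. exact: mem_head. Qed.

(** Restarting at a later vertex of A, or stopping at an earlier vertex of B, shortens the link, so
    induction on its length applies. The subsequence clause keeps a family disjoint when all its
    members are trimmed. *)
Lemma trim r A B l : link r A B l ->
  exists l', [/\ link r A B l', tight A B l' & subseq (verts l') (verts l)].
Proof.
case: l => x p; move: {2}(size p) (leqnn (size p)) => n.
elim: n x p => [|n IHn] x p.
  rewrite leqn0 size_eq0 => /eqP-> lk; exists (x, [::]); split=> //.
  by split=> z; rewrite inE => /eqP.
move=> szp lk; have /and4P[xA pB pp up] := lk; rewrite /lend /= in xA pB pp.
have [/hasP[z zp zA]|noA] := boolP (has (mem A) p).
  case/path.splitP: zp szp lk pB pp up => p1 p2 szp lk.
  rewrite last_cat last_rcons cat_path last_rcons => pB /andP[_ pp2].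
  rewrite -[verts _]/((x :: _) ++ p2) cat_uniq => /and3P[_ nh up2].
  have [||l' [lk' t' s']] := IHn z p2.
  - by move: szp; rewrite size_cat size_rcons; lia.
  - apply/and4P; split=> //=; rewrite up2 andbT.
    apply/negP=> zp2; case/negP: nh; apply/hasP; exists z => //.
    by rewrite inE mem_rcons mem_head orbT.
  exists l'; split=> //; apply: subseq_trans s' _.
  rewrite [X in subseq _ X](_ : _ = (x :: p1) ++ (z :: p2)) ?suffix_subseq //.
  by rewrite -cat_rcons.
have [/hasP[z zp zB]|noB] := boolP (has (mem B) (belast x p)).
  have zp' : z \in x :: p by rewrite lastI mem_rcons inE zp orbT.
  case/path.splitPl: zp' zp szp lk pB pp up noA => p1 p2 lz zp szp lk.
  rewrite cat_path -[verts _]/((x :: p1) ++ p2) => pB /andP[pp1 _].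
  rewrite cat_uniq has_cat negb_or => /and3P[up1 _ _] /andP[_ _].
  case: p2 => [|y p2] in zp szp lk pB *.
    by move: up1; rewrite lastI rcons_uniq lz -{1}(cats0 p1) zp.
  have [||l' [lk' t' s']] := IHn x p1.
  - by move: szp; rewrite size_cat /=; lia.
  - by apply/and4P; split; rewrite //= /lend /= lz.
  exists l'; split=> //; apply: subseq_trans s' _.
  exact: (prefix_subseq (x :: p1) (y :: p2)).
exists (x, p); split=> //; split=> z /=.
  rewrite inE => /predU1P[//|zp] zA.
  by case/hasP: noA; exists z.
rewrite /verts /= lastI mem_rcons inE => /predU1P[//|zp] zB.
by case/hasP: noB; exists z.
Qed.

Lemma disj_cons l ls : disj (l :: ls) =
  [&& uniq (verts l), ~~ has (mem (verts l)) (flatten (map verts ls)) & disj ls].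
Proof. exact: cat_uniq. Qed.

Lemma disj_inj ls z l l' : disj ls -> l \in ls -> l' \in ls ->
  z \in verts l -> z \in verts l' -> l = l'.
Proof.
elim: ls => // m ls IHls; rewrite disj_cons => /and3P[_ /hasPn nh dl].
have mem_fl u : u \in ls -> z \in verts u -> z \in flatten (map verts ls).
  by move=> uls zu; apply/flattenP; exists (verts u) => //; apply: map_f.
rewrite !inE => /predU1P[->|lls] /predU1P[->|lls'] // zl zl'.
- by case/negP: (nh _ (mem_fl _ lls' zl')).
- by case/negP: (nh _ (mem_fl _ lls zl)).
- exact: IHls.
Qed.

Lemma disj_uniq ls : disj ls -> uniq ls.
Proof.
elim: ls => // m ls IHls; rewrite disj_cons => /and3P[_ /hasPn nh dl] /=.
rewrite IHls // andbT; apply/negP=> mls.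
have /nh/negP : m.1 \in flatten (map verts ls).
  by apply/flattenP; exists (verts m); rewrite ?map_f ?fst_verts.
by apply; apply: fst_verts.
Qed.

Lemma disjP ls : uniq ls -> {in ls, forall l, uniq (verts l)} ->
  {in ls &, forall l l' z, z \in verts l -> z \in verts l' -> l = l'} -> disj ls.
Proof.
elim: ls => // m ls IHls /andP[mls uls] ul dl; rewrite disj_cons (ul m (mem_head _ _)).
rewrite IHls // ?andbT; last 2 first.
- by move=> l lls; apply: ul; rewrite inE lls orbT.
- by move=> l l' lls lls'; apply: dl; rewrite inE ?lls ?lls' orbT.
apply/hasPn=> z /flattenP[_ /mapP[l lls ->] zl]; apply/negP=> zm.
have lm : m = l by apply: (dl _ _ _ _ z) => //; rewrite inE ?eqxx ?lls ?orbT.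
by rewrite lm lls in mls.
Qed.

Lemma disj_map ls (f : T * seq T -> T) : disj ls ->
  (forall l, f l \in verts l) -> uniq (map f ls).
Proof.
move=> dls fv; rewrite map_inj_in_uniq ?disj_uniq // => l l' lls lls' eqf.
by apply: (disj_inj dls lls lls' (fv l)); rewrite eqf.
Qed.

Lemma trim_all r A B ls : all (link r A B) ls -> disj ls ->
  exists ls', [/\ size ls' = size ls, all (link r A B) ls', disj ls' &
    {in ls', forall l, tight A B l}].
Proof.
move=> als dls.
suff [ls' [sz al tl sb]] : exists ls', [/\ size ls' = size ls,
    all (link r A B) ls', {in ls', forall l, tight A B l} &
    subseq (flatten (map verts ls')) (flatten (map verts ls))].
  by exists ls'; split=> //; apply: subseq_uniq dls.
elim: ls als {dls} => [|l ls IHls]; first by exists [::].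
move=> /andP[/trim[l' [lk tl sl]] /IHls[ls' [sz al tls sls]]].
exists (l' :: ls'); split; first by rewrite /= sz.
- by rewrite /= lk.
- by move=> u; rewrite inE => /predU1P[->//|]; apply: tls.
- exact: (cat_subseq sl sls).
Qed.

Definition sep r A B S := forall x p,
  x \in A -> path r x p -> last x p \in B -> has (mem S) (x :: p).

Lemma link_disj_sub r r' A B l : subrel r r' -> link r A B l -> link r' A B l.
Proof.
by move=> sr /and4P[lA lB pl ul]; apply/and4P; split=> //; apply: sub_path pl.
Qed.

Lemma has_setP S (s : seq T) :
  reflect (exists2 z, z \in s & z \in S) (has (mem S) s).
Proof. exact: hasP. Qed.

Lemma first_hit S x p : has (mem S) (x :: p) -> exists p1 p2,
  [/\ p = p1 ++ p2, last x p1 \in S & ~~ has (mem S) (belast x p1)].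
Proof.
elim: p x => [|y p IHp] x /=.
  by rewrite orbF => xS; exists [::], [::].
have [xS _|xS /IHp[p1 [p2 [-> lS nS]]]] := boolP (x \in S).
  by exists [::], (y :: p).
by exists (y :: p1), p2; split; rewrite //= negb_or xS.
Qed.

Lemma last_hit S x p : has (mem S) (x :: p) -> exists p1 p2,
  [/\ p = p1 ++ p2, last x p1 \in S & ~~ has (mem S) p2].
Proof.
elim: p x => [|y p IHp] x.
  by rewrite /= orbF => xS; exists [::], [::].
have [/IHp[p1 [p2 [-> lS nS]]] _|nS] := boolP (has (mem S) (y :: p)).
  by exists (y :: p1), p2.
by rewrite /= -[_ || has _ _]/(has (mem S) (y :: p)) (negPf nS) orbF => xS;
  exists [::], (y :: p).
Qed.

(** Relations are read as directed graphs here: only the ordered pair is removed. *)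
Definition del r (x y : T) : rel T := fun u v => r u v && ((u, v) != (x, y)).

Lemma path_del_fst r x y a p : path r a p -> x \notin belast a p ->
  path (del r x y) a p.
Proof.
elim: p a => //= b p IHp a /andP[rab pp]; rewrite inE negb_or => /andP[nx np].
by rewrite IHp // /del rab xpair_eqE eq_sym (negPf nx).
Qed.

Lemma path_del_snd r x y a p : path r a p -> y \notin p -> path (del r x y) a p.
Proof.
elim: p a => //= b p IHp a /andP[rab pp]; rewrite inE negb_or => /andP[nx np].
by rewrite IHp // /del rab xpair_eqE [b == y]eq_sym (negPf nx) andbF.
Qed.

Lemma sep_del_fst r A B S x y : sep (del r x y) A B S -> sep r A B (x |: S).
Proof.
move=> sS a p aA pp lB; have [xp|xp] := boolP (x \in a :: p).
  by apply/has_setP; exists x; rewrite //= !inE eqxx.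
have /has_setP[z zp zS] : has (mem S) (a :: p).
  apply: sS aA _ lB; apply: path_del_fst pp _.
  by apply: contra xp => /mem_belast.
by apply/has_setP; exists z; rewrite //= !inE zS orbT.
Qed.

Lemma sep_del_snd r A B S x y : sep (del r x y) A B S -> sep r A B (y |: S).
Proof.
move=> sS a p aA pp lB; have [xp|xp] := boolP (y \in a :: p).
  by apply/has_setP; exists y; rewrite //= !inE eqxx.
have /has_setP[z zp zS] : has (mem S) (a :: p).
  apply: sS aA _ lB; apply: path_del_snd pp _.
  by apply: contra xp => xp; rewrite inE xp orbT.
by apply/has_setP; exists z; rewrite //= !inE zS orbT.
Qed.

(** Up to its first vertex in S, a walk can meet x only at the end, so this initial segment does not
    use the deleted arc out of x and must meet S1. *)
Lemma sep_left r A B S S1 x y : sep r A B S -> x \in S ->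
  sep (del r x y) A S S1 -> sep r A B S1.
Proof.
move=> sS xS sS1 a p aA pp lB.
have [p1 [p2 [ep lS nS]]] := first_hit (sS a p aA pp lB).
move: pp; rewrite ep cat_path => /andP[pp1 _].
suff : has (mem S1) (a :: p1) by rewrite -cat_cons has_cat => ->.
apply: sS1 => //; apply: path_del_fst pp1 _.
by apply: contra nS => xp; apply/has_setP; exists x.
Qed.

Lemma sep_right r A B S S1 x y : sep r A B S -> y \in S ->
  sep (del r x y) S B S1 -> sep r A B S1.
Proof.
move=> sS yS sS1 a p aA pp lB.
have [p1 [p2 [ep lS nS]]] := last_hit (sS a p aA pp lB).
move: pp lB; rewrite ep cat_path last_cat => /andP[_ pp2] lB.
have /has_setP[z zp zS] : has (mem S1) (last a p1 :: p2).
  apply: sS1 => //; apply: path_del_snd pp2 _.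
  by apply: contra nS => xp; apply/has_setP; exists y.
apply/has_setP; exists z => //; move: zp; rewrite inE => /predU1P[->|zp].
  by rewrite -cat_cons mem_cat mem_last.
by rewrite inE mem_cat zp !orbT.
Qed.

Lemma cover_set S (t : seq T) : uniq t -> {subset t <= S} -> size t = #|S| ->
  {subset S <= t}.
Proof.
move=> ut tS szt z zS.
have [] := @uniq_min_size _ t (enum S) ut; last 1 first.
- by move=> _ ->; rewrite mem_enum.
- by move=> w /tS; rewrite mem_enum.
- by rewrite -cardE szt.
Qed.

Definition pick_by (f : T * seq T -> T) ls z := nth (z, [::]) ls (index z (map f ls)).

Lemma pick_byP f ls z : z \in map f ls -> pick_by f ls z \in ls /\ f (pick_by f ls z) = z.
Proof.
move=> zf; have szi : index z (map f ls) < size ls.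
  by rewrite -(size_map f) index_mem.
split; first exact: mem_nth.
by rewrite /pick_by -(nth_map _ z) // nth_index.
Qed.

(** Following a up to z and then b gives a walk from A to B, which meets S. By tightness, a hit on
    the first part is the end of a, which forces z to be that end; a hit on the second part after z
    is impossible. *)
Lemma link_cross r A B (Sx Sy : {set T}) S (a b : T * seq T) z : sep r A B S ->
  {subset S <= Sx} -> {subset S <= Sy} ->
  link r A Sx a -> link r Sy B b -> tight A Sx a -> tight Sy B b ->
  z \in verts a -> z \in verts b -> [/\ z \in S, z = lend a & z = b.1].
Proof.
case: a b => [a p] [b q] sS sSx sSy /and4P[aA lp pp up] /and4P[bS lq pq uq].
move=> [_ ta] [tb _] zp zq.
rewrite /lend /= in aA lp pp bS lq pq ta tb *.
have ap' : z \in a :: p by []. have bq' : z \in b :: q by [].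
move: up ta; rewrite /verts [(a, p).1]/= [(a, p).2]/= => up ta.
move: uq tb; rewrite /verts [(b, q).1]/= [(b, q).2]/= => uq tb {zp zq}.
case/path.splitPl: ap' up pp ta lp => p1 p2 lz.
rewrite -cat_cons cat_uniq cat_path last_cat lz.
move=> /and3P[_ /hasPn h2 _] /andP[pp1 _] ta lp.
case/path.splitPl: bq' uq pq tb lq => q1 q2 lz'.
rewrite -cat_cons cat_uniq cat_path last_cat lz'.
move=> /and3P[_ /hasPn g2 _] /andP[_ pq2] tb lq.
have : has (mem S) (a :: p1 ++ q2).
  by apply: sS => //; rewrite ?cat_path ?last_cat ?lz ?pp1.
rewrite -cat_cons has_cat => /orP[] /has_setP[w wp wS].
  have ew : w = last z p2 by apply: ta; rewrite ?sSx // mem_cat wp.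
  case: p2 => [|c p2] in h2 ta lp ew *.
    rewrite /= in ew *; rewrite -ew; split=> //; rewrite ew.
    by apply: tb; rewrite ?sSy -?ew // ew -lz' mem_cat mem_last.
  have /h2/negP[] : w \in c :: p2 by rewrite ew /= mem_last.
  exact: wp.
have /g2/negP[] := wp; have -> : w = b by apply: tb; rewrite ?sSy // mem_cat wp orbT.
exact: mem_head.
Qed.

(** A vertex that is both the end of a and the origin of b is kept once; otherwise an arc must lead
    from one to the other. *)
Definition glue (a b : T * seq T) : T * seq T :=
  (a.1, a.2 ++ (if lend a == b.1 then b.2 else verts b)).

Lemma glue_verts a b z : z \in verts (glue a b) -> z \in verts a \/ z \in verts b.
Proof.
have -> : verts (glue a b) =
  verts a ++ (if lend a == b.1 then b.2 else verts b) by [].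
rewrite mem_cat => /orP[|zb]; [by left|right].
by case: ifP zb => // _ zb; apply: mem_behead.
Qed.

Lemma glue_link r A B (Sx Sy : {set T}) (a b : T * seq T) : link r A Sx a -> link r Sy B b ->
  lend a = b.1 \/ r (lend a) b.1 ->
  (forall z, z \in verts a -> z \in verts b -> z = lend a /\ z = b.1) ->
  link r A B (glue a b).
Proof.
case: a b => [a p] [b q] /and4P[aA _ pp up] /and4P[_ lq pq uq] ab cr.
rewrite /glue /lend /= in aA pp lq pq ab cr *; case: ifP => [/eqP eab|/eqP nab].
  apply/and4P; split=> //; last 1 first; last 2 first.
  - by rewrite /lend /= last_cat eab.
  - by rewrite /= cat_path pp eab.
  rewrite -[verts _]/((a :: p) ++ q) cat_uniq up; case/andP: (uq) => /= nq _.
  have -> : uniq q by case/andP: uq.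
  rewrite andbT; apply/hasPn=> z zq; apply/negP=> za.
  by have [_ zb] := cr z za (@mem_behead _ (b :: q) _ zq); rewrite -zb zq in nq.
case: ab => // rab.
apply/and4P; split=> //; last 1 first; last 2 first.
- by rewrite /lend /= last_cat.
- by rewrite /= cat_path /= rab pp.
rewrite -[verts _]/((a :: p) ++ (b :: q)) cat_uniq up.
have -> : uniq (b :: q) by [].
rewrite andbT; apply/hasPn=> z zq; apply/negP=> za.
by have [za' zb'] := cr z za zq; rewrite -za' -zb' in nab.
Qed.

(* Induction on the number of arcs.  If deleting the arc (x, y) creates a separator S
   with fewer than k vertices, then x |: S and y |: S separate A from B, and k links
   from A to x |: S are glued to k links from y |: S to B. *)
Lemma menger r A B k : (forall S, sep r A B S -> k <= #|S|) ->
  exists ls, [/\ size ls = k, all (link r A B) ls & disj ls].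
Proof.
have [n] := ubnP #|[set z : T * T | r z.1 z.2]|; elim: n => // n IHn in r A B k *.
rewrite ltnS => rn sk.
(* Without arcs, [A :&: B] separates, and its vertices are links of length 0. *)
have [r0|] := eqVneq [set z : T * T | r z.1 z.2] set0.
  have r0' u v : r u v = false by have /setP/(_ (u, v)) := r0; rewrite !inE.
  have kAB : k <= #|A :&: B|.
    apply: sk => x [|y p] xA /=; last by rewrite r0'.
    by move=> _ xB; rewrite inE xA xB.
  exists (take k [seq (x, [::]) | x <- enum (A :&: B)]); split.
  - by rewrite size_takel // size_map -cardE.
  - apply/allP=> l /mem_take/mapP[x]; rewrite mem_enum inE => /andP[xA xB] ->.
    by apply/and4P.
  - rewrite /disj map_take -map_comp.
    have -> : map (verts \o fun x => (x, [::])) (enum (A :&: B)) =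
       map (fun x => [:: x]) (enum (A :&: B)) by [].
    rewrite -map_take flatten_map1 map_id take_uniq ?enum_uniq //.
case/set0Pn=> [[x y]]; rewrite inE /= => rxy.
set r' := del r x y.
have r'r : subrel r' r by move=> u v /andP[].
have r'n : #|[set z : T * T | r' z.1 z.2]| < n.
  apply: leq_trans rn; apply: proper_card; apply/properP; split.
    by apply/subsetP=> z; rewrite !inE => /r'r.
  by exists (x, y); rewrite !inE //= /r' /del eqxx andbF.
have [[S sS ltS]|nex] := pselect (exists2 S, sep r' A B S & #|S| < k); last first.
  have [S sS|ls [sz al dl]] := IHn r' A B k r'n.
    by rewrite leqNgt; apply/negP=> lt; apply: nex; exists S.
  by exists ls; split=> //; apply: sub_all al => l; apply: link_disj_sub.
have sx := sep_del_fst sS; have sy := sep_del_snd sS.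
have [kS xS yS] : [/\ #|S|.+1 = k, x \notin S & y \notin S].
  move: (sk _ sx) (sk _ sy); rewrite !cardsU1.
  by do 2![case: (_ \in S) => /=]; split=> //; lia.
set Sx := x |: S in sx *; set Sy := y |: S in sy *.
have xSx : x \in Sx by rewrite !inE eqxx.
have ySy : y \in Sy by rewrite !inE eqxx.
have cSx : #|Sx| = k by rewrite cardsU1 xS.
have cSy : #|Sy| = k by rewrite cardsU1 yS.
have sSx : {subset S <= Sx} by move=> z zS; rewrite !inE zS orbT.
have sSy : {subset S <= Sy} by move=> z zS; rewrite !inE zS orbT.
have [S1 sS1|la0 [sza0 ala0 dla0]] := IHn r' A Sx k r'n.
  exact: sk (sep_left sx xSx sS1).
have [S1 sS1|lb0 [szb0 alb0 dlb0]] := IHn r' Sy B k r'n.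
  exact: sk (sep_right sy ySy sS1).
have [la [sza ala dla ta]] := trim_all ala0 dla0.
have [lb [szb alb dlb tb]] := trim_all alb0 dlb0.
have covA : {subset Sx <= map lend la}.
  apply: cover_set; first exact: disj_map dla lend_verts.
    by move=> _ /mapP[l /(allP ala)/and4P[_ ? _ _] ->].
  by rewrite size_map sza sza0 cSx.
have covB : {subset Sy <= map fst lb}.
  apply: cover_set; first exact: disj_map dlb fst_verts.
    by move=> _ /mapP[l /(allP alb)/and4P[? _ _ _] ->].
  by rewrite size_map szb szb0 cSy.
(* A link ending at x is continued across the deleted arc by the link starting at y; at a vertex of
   S the two links share that vertex. *)
pose ph s := if s == x then y else s.
have phS s : s \in Sx -> ph s \in Sy.
  by rewrite /ph !inE; case: eqVneq => [_ _|_ /= ->]; rewrite ?eqxx ?orbT.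
pose pa s := pick_by lend la s; pose pb s := pick_by fst lb (ph s).
have paP s : s \in Sx -> pa s \in la /\ lend (pa s) = s.
  by move=> /covA/pick_byP.
have pbP s : s \in Sx -> pb s \in lb /\ (pb s).1 = ph s.
  by move=> /phS/covB/pick_byP.
have cross s s' z : s \in Sx -> s' \in Sx -> z \in verts (pa s) -> z \in verts (pb s') ->
    [/\ z \in S, z = s & z = ph s'].
  move=> sX s'X za zb; have [sa ea] := paP s sX; have [sb eb] := pbP s' s'X.
  have := link_cross sS sSx sSy (allP ala _ sa) (allP alb _ sb) (ta _ sa) (tb _ sb) za zb.
  by rewrite ea eb.
have inS s : s \in Sx -> ph s \in S -> ph s = s.
  by rewrite /ph; case: eqP => //; rewrite (negPf yS).
pose gl s := glue (pa s) (pb s).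
have gdis s s' z : s \in Sx -> s' \in Sx ->
    z \in verts (gl s) -> z \in verts (gl s') -> s = s'.
  move=> sX s'X /glue_verts zs /glue_verts zs'.
  have [sa ea] := paP s sX; have [sa' ea'] := paP s' s'X.
  have [sb eb] := pbP s sX; have [sb' eb'] := pbP s' s'X.
  case: zs zs' => [za|zb] [za'|zb'].
  - by rewrite -ea -ea' (disj_inj dla sa sa' za za').
  - have [zS ez ez'] := cross _ _ _ sX s'X za zb'; rewrite -ez ez' inS //.
    by rewrite -ez'.
  - have [zS ez' ez] := cross _ _ _ s'X sX za' zb; rewrite -ez' ez inS //.
    by rewrite -ez.
  - have : ph s = ph s' by rewrite -eb -eb' (disj_inj dlb sb sb' zb zb').
    rewrite /ph; case: eqVneq => [->|_]; case: eqVneq => [->|_] // eqs.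
      by move: s'X; rewrite -eqs !inE (negPf yS) orbF => /eqP.
    by move: sX; rewrite eqs !inE (negPf yS) orbF => /eqP.
have gfst s : (gl s).1 \in verts (gl s) by exact: fst_verts.
have glL s : s \in Sx -> link r A B (gl s).
  move=> sX; have [sa ea] := paP s sX; have [sb eb] := pbP s sX.
  apply: glue_link (link_disj_sub r'r (allP ala _ sa)) (link_disj_sub r'r (allP alb _ sb)) _ _.
    rewrite ea eb /ph; case: eqVneq => [->|_]; last by left.
    by right.
  by move=> z za zb; rewrite ea eb; have [] := cross _ _ _ sX sX za zb.
exists (map gl (enum Sx)); split.
- by rewrite size_map -cardE.
- by apply/allP=> l /mapP[s]; rewrite mem_enum => sX ->; apply: glL.
- apply: disjP.
  + rewrite map_inj_in_uniq ?enum_uniq // => s s'; rewrite !mem_enum => sX s'X eqg.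
    by apply: (gdis _ _ (gl s).1 sX s'X); rewrite -?eqg gfst.
  + by move=> l /mapP[s]; rewrite mem_enum => /glL/and4P[_ _ _ ?] ->.
  + move=> l l' /mapP[s]; rewrite mem_enum => sX -> /mapP[s'].
    by rewrite mem_enum => s'X -> z zs zs'; rewrite (gdis s s' z).
Qed.
End Menger.

(** * Arcs of cycles *)

(** For positive g, the map [i.*2 %/ g] is injective on t, with values at most [N.*2 %/ g]. *)
Lemma spread_leq (t : seq nat) g N : uniq t -> {in t, forall i, i <= N} ->
  {in t &, forall i j, i < j -> g <= (j - i).*2} -> (size t).-1 * g <= N.*2.
Proof.
case: g => [|g] ut tN dt; first by rewrite muln0.
pose f i := i.*2 %/ g.+1.
have nf i j : i \in t -> j \in t -> i < j -> f i = f j -> False.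
  move=> it jt ij; have := dt i j it jt ij; rewrite /f.
  have := ltn_ceil j.*2 (ltn0Sn g); have := leq_divM i.*2 g.+1.
  by move=> + + + eqf; rewrite eqf mulSn; lia.
have uf : uniq (map f t).
  rewrite map_inj_in_uniq // => i j it jt eqf.
  have [ij|ji|//] := ltngtP i j; first by have := nf i j it jt ij eqf.
  by have := nf j i jt it ji (esym eqf).
have : size (map f t) <= size (iota 0 (N.*2 %/ g.+1).+1).
  apply: uniq_leq_size => // _ /mapP[i it ->]; rewrite mem_iota /= add0n ltnS.
  by apply: leq_div2r; rewrite leq_double tN.
rewrite size_map size_iota => szt.
apply: leq_trans (leq_divM N.*2 g.+1); rewrite leq_mul2r /=; by case: (size t) szt.
Qed.

Section Paths.
Variables (T : finType) (e : rel T).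
Hypothesis e_sym : symmetric e.

Lemma path_rev x p : path e x p -> path e (last x p) (rev (belast x p)).
Proof.
by rewrite rev_path; under eq_path => u v do rewrite e_sym.
Qed.

Lemma idx_mem (z : T) (s : seq T) : (index z s < size s) = (z \in s).
Proof. exact: index_mem. Qed.

Lemma split_two (c : seq T) x y : uniq c -> y \in c -> index x c < index y c ->
  exists a b d, [/\ c = a ++ x :: b ++ y :: d, index x c = size a &
    index y c = (size a + size b).+1].
Proof.
move=> uc yc ixy; have xc : x \in c.
  by rewrite -index_mem (ltn_trans ixy) // index_mem.
case/path.splitPr: xc uc yc ixy => a c'.
rewrite cat_uniq /= => /and3P[_ /norP[xa ha] _] yc.
rewrite !index_cat (negPf xa) /= eqxx addn0.
case: ifP => ya; first by rewrite ltnNge index_size.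
case: eqP => [->|/eqP xy _]; first by rewrite addn0 ltnn.
move: yc; rewrite mem_cat ya inE [y == x]eq_sym (negPf xy) /= => yc'.
rewrite -[X in a ++ x :: X](cat_take_drop (index y c')).
rewrite (drop_nth y) ?index_mem // nth_index //.
by exists a, (take (index y c') c'), (drop (index y c').+1 c'); split;
  rewrite // size_take index_mem yc' addnS.
Qed.

Lemma arc_paths a x b y d : cycle e (a ++ x :: b ++ y :: d) ->
  path e x (rcons b y) /\ path e y (rcons (d ++ a) x).
Proof.
rewrite -(rot_cycle (size a)) rot_size_cat /= -catA /= -cat_rcons rcons_cat cat_path.
by rewrite last_rcons => /andP[].
Qed.

Lemma detour_rev x m y : path e x (rcons m y) -> path e y (rcons (rev m) x).
Proof. by move/path_rev; rewrite last_rcons belast_rcons rev_cons. Qed.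

Lemma index_parts (a b d : seq T) x y (c := a ++ x :: b ++ y :: d) z : uniq c ->
  [/\ z \in a -> index z c < size a, z \in b -> size a < index z c < (size a + size b).+1
    & z \in d -> (size a + size b).+1 < index z c].
Proof.
rewrite /c cat_uniq /= cat_uniq /= mem_cat !inE has_cat /= !negb_or.
case/and4P=> _ /and4P[xa /hasPn ba ya /hasPn da] /and3P[xb xy xd] /and3P[_ /andP[yb /hasPn db] /andP[yd _]].
rewrite index_cat; split=> [za|zb|zd].
- by rewrite za index_mem.
- rewrite (negPf (ba z zb)) /=; case: eqP => [exz|_]; first by rewrite exz zb in xb.
  by rewrite index_cat zb; move: zb; rewrite -idx_mem; lia.
- rewrite (negPf (da z zd)) /=; case: eqP => [exz|_]; first by rewrite exz zd in xd.
  rewrite index_cat (negPf (db z zd)) /=.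
  by case: eqP => [exz|_]; [rewrite exz zd in yd | lia].
Qed.

(* The first arc runs through the indices strictly between those of x and y, the
   second one wraps around. *)
Lemma arcs c x y : uniq c -> cycle e c -> x \in c -> y \in c -> x != y ->
  let lo := minn (index x c) (index y c) in
  let hi := maxn (index x c) (index y c) in
  (exists2 m, path e x (rcons m y) /\ uniq m &
    (forall z, (z \in m) = (z \in c) && (lo < index z c < hi)) /\ size m = (hi - lo).-1) /\
  (exists2 m, path e x (rcons m y) /\ uniq m &
    (forall z, (z \in m) = (z \in c) && ((index z c < lo) || (hi < index z c))) /\
    size m + (hi - lo).+1 = size c).
Proof.
move=> uc cc; wlog ixy : x y / index x c < index y c => [IH xc yc xy|xc yc xy].
  have [ixy|] := boolP (index x c < index y c); first exact: IH.
  rewrite -leqNgt leq_eqVlt => /predU1P[eqi|iyx].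
    by case/eqP: xy; rewrite -(nth_index x xc) -eqi nth_index.
  have := IH y x iyx yc xc; rewrite eq_sym minnC maxnC => /(_ xy).
  move=> [[m [pm um] [hm sm]] [m' [pm' um'] [hm' sm']]]; split.
    exists (rev m); rewrite ?rev_uniq ?size_rev; split=> //; first exact: detour_rev.
    by move=> z; rewrite mem_rev.
  exists (rev m'); rewrite ?rev_uniq ?size_rev; split=> //; first exact: detour_rev.
  by move=> z; rewrite mem_rev.
rewrite (minn_idPl (ltnW ixy)) (maxn_idPr (ltnW ixy)) /=.
have [a [b [d [ec ix iy]]]] := split_two uc yc ixy.
have := cc; rewrite {1}ec => /arc_paths[p1 p2].
have := uc; rewrite {1}ec cat_uniq /= cat_uniq /= mem_cat !inE has_cat /= !negb_or.
case/and4P=> ua /and4P[xa /hasPn ba ya /hasPn da] /and3P[xb _ xd].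
move=> /and3P[ub /andP[yb /hasPn db] /andP[yd ud]].
have szc : size c = (size a + size b + size d).+2.
  by rewrite ec size_cat /= size_cat /= !addnS addnA.
have zP z : z \in c -> [|| z \in a, z == x, z \in b, z == y | z \in d].
  by rewrite ec !(mem_cat, inE).
have iP z := @index_parts a b d x y z; rewrite -ec in iP.
have ac z : z \in a -> z \in c by rewrite ec mem_cat => ->.
have bc z : z \in b -> z \in c by rewrite ec !(mem_cat, inE) => ->; rewrite !orbT.
have dc z : z \in d -> z \in c by rewrite ec !(mem_cat, inE) => ->; rewrite !orbT.
rewrite ix iy; split.
  exists b => //; split; last by rewrite subSn ?leq_addr // addKn.
  move=> z; have [pa pb pd] := iP z uc; apply/idP/idP.
    by move=> zb; rewrite bc // pb.
  case/andP=> zc iz; case/or4P: (zP z zc) => [/pa|/eqP ez|//|/orP[/eqP ez|/pd]].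
  - move: iz; size_lia.
  - by move: iz; rewrite ez ix; size_lia.
  - by move: iz; rewrite ez iy; size_lia.
  - by move: iz; size_lia.
exists (rev (d ++ a)); first split.
- exact: detour_rev.
- rewrite rev_uniq cat_uniq ud ua andbT /=; apply/hasPn=> z za; apply/negP=> zd.
  by have /negP[] := da z zd.
- rewrite size_rev size_cat; split; last by rewrite szc; size_lia.
  move=> z; have [pa pb pd] := iP z uc; rewrite mem_rev mem_cat; apply/idP/idP.
    by case/orP=> [zd|za]; [rewrite dc // pd // orbT|rewrite ac // pa].
  case/andP=> zc iz; case/or4P: (zP z zc) => [->|/eqP ez|/pb|/orP[/eqP ez|->//]].
  - by rewrite orbT.
  - by move: iz; rewrite ez ix; size_lia.
  - by move: iz; size_lia.
  - by move: iz; rewrite ez iy; size_lia.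
Qed.

(** The two arcs together contain all vertices of c except x and y; the longer arc is taken. *)
Lemma long_arc c x y : uniq c -> cycle e c -> x \in c -> y \in c -> x != y ->
  exists m, [/\ path e x (rcons m y), uniq m, {subset m <= c}, x \notin m /\ y \notin m
   & size c <= (size m).*2.+2].
Proof.
move=> uc cc xc yc xy; have /= := arcs uc cc xc yc xy.
case=> [[m [pm um] [hm sm]] [m' [pm' um'] [hm' sm']]].
have nlo (m0 := minn (index x c) (index y c)) (m1 := maxn (index x c) (index y c)) i :
    i = index x c \/ i = index y c -> ~ (m0 < i < m1) /\ ~ ((i < m0) || (m1 < i)).
  by rewrite /m0 /m1; size_lia.
move: nlo sm sm' hm hm'; set lo := minn _ _; set hi := maxn _ _ => nlo sm sm' hm hm'.
have [le|lt] := leqP (size m) (size m').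
  exists m'; split=> //; last by move: sm sm' le; size_lia.
    by move=> z; rewrite hm' => /andP[].
  by rewrite !hm' xc yc; split; apply/negP; [case: (nlo (index x c)) | case: (nlo (index y c))]; auto.
exists m; split=> //; last by move: sm sm' lt; size_lia.
  by move=> z; rewrite hm => /andP[].
by rewrite !hm xc yc; split; apply/negP; [case: (nlo (index x c)) | case: (nlo (index y c))]; auto.
Qed.

End Paths.

(** * The transversal weight of a vertex set *)

Section Framework.
Variables (T : finType) (e : rel T) (F : {set {set T}}).
Hypothesis e_sym : symmetric e.
Implicit Types (A B S W Z Q : {set T}) (s p q : seq T) (l : T * seq T).

Definition touches A B := [exists x in A, x \in B].

Lemma touchesP A B : reflect (exists2 x, x \in A & x \in B) (touches A B).
Proof. exact: exists_inP. Qed.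

(** S may leave W; only the members that touch W have to be hit. *)
Definition hit W S := [forall Q in F, touches Q W ==> touches Q S].

Lemma hitP W S : reflect (forall Q, Q \in F -> touches Q W -> touches Q S) (hit W S).
Proof.
apply: (iffP forall_inP) => h Q QF; first by move=> QW; have /implyP := h Q QF; apply.
by apply/implyP; apply: h.
Qed.

(* The weight of the whole vertex set is the transversal number of F. *)
Definition tv W := #|[arg min_(S < W | hit W S) #|S|]|.

Lemma hit_refl W : hit W W. Proof. by apply/hitP. Qed.

Lemma tv_min W S : hit W S -> tv W <= #|S|.
Proof. by rewrite /tv; case: arg_minnP => [|S0 _ min hS]; [exact: hit_refl | exact: min]. Qed.

Lemma tv_ex W : exists2 S, hit W S & #|S| = tv W.
Proof. by rewrite /tv; case: arg_minnP => [|S hS _]; [exact: hit_refl | exists S]. Qed.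

Lemma tv_card W : tv W <= #|W|.
Proof. exact/tv_min/hit_refl. Qed.

Lemma tvS W W' : W \subset W' -> tv W <= tv W'.
Proof.
move=> /subsetP sW; have [S /hitP hS <-] := tv_ex W'; apply/tv_min/hitP=> Q QF.
by case/touchesP=> x xQ xW; apply: hS => //; apply/touchesP; exists x; auto.
Qed.

Lemma touchesU Q W W' : touches Q (W :|: W') = touches Q W || touches Q W'.
Proof.
apply/touchesP/orP=> [[x xQ]|[] /touchesP[x xQ xW]].
- by rewrite inE => /orP[] xW; [left|right]; apply/touchesP; exists x.
- by exists x; rewrite // inE xW.
- by exists x; rewrite // inE xW orbT.
Qed.

Lemma tvU W W' : tv (W :|: W') <= tv W + tv W'.
Proof.
have [S /hitP hS <-] := tv_ex W; have [S' /hitP hS' <-] := tv_ex W'.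
apply: leq_trans (leq_card_setU S S'); apply/tv_min/hitP=> Q QF.
by rewrite !touchesU => /orP[/(hS Q QF)->|/(hS' Q QF)->]; rewrite ?orbT.
Qed.

Lemma tv_cover W W1 W2 : W \subset W1 :|: W2 -> tv W <= tv W1 + tv W2.
Proof. by move/tvS/leq_trans; apply; apply: tvU. Qed.

(** Otherwise S together with an optimal hitting set for Z would hit every member touching W, with
    fewer than [tv W] vertices. *)
Lemma avoid S W Z : #|S| + tv Z < tv W ->
  exists Q, [/\ Q \in F, touches Q W, ~~ touches Q S & ~~ touches Q Z].
Proof.
have [SZ /hitP hZ <-] := tv_ex Z => lt; apply: contrapT => nex.
have /hitP/tv_min : forall Q, Q \in F -> touches Q W -> touches Q (S :|: SZ).
  move=> Q QF QW; apply: contrapT => /negP; rewrite touchesU negb_or => /andP[nS nSZ].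
  by apply: nex; exists Q; split=> //; apply: contra nSZ; apply: hZ.
by rewrite leqNgt => /negP[]; apply: leq_ltn_trans lt; exact: leq_card_setU.
Qed.

Lemma tv_setT W : (forall Q, Q \in F -> touches Q W) -> tv W = tv setT.
Proof.
move=> h; apply/eqP; rewrite eqn_leq tvS ?subsetT //=.
have [S /hitP hS <-] := tv_ex W; apply/tv_min/hitP=> Q QF _.
by apply: hS => //; apply: h.
Qed.

Lemma tv0 : tv set0 = 0.
Proof. by apply/eqP; rewrite -leqn0 -(cards0 T) tv_card. Qed.

Lemma tv_le W : tv W <= tv setT.
Proof. exact/tvS/subsetT. Qed.

Lemma path_join l m l' : path e l.1 l.2 -> path e l.1 (rcons m l'.1) ->
  path e l'.1 l'.2 -> path e (lend l) (rev (belast l.1 l.2) ++ m ++ verts l').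
Proof.
move=> pl pm pl'; rewrite cat_path (path_rev e_sym pl).
have -> : last (lend l) (rev (belast l.1 l.2)) = l.1.
  by case: l {pl pm} => x [|y p]; rewrite //= rev_cons last_rcons.
by rewrite -cat_rcons cat_path pm last_rcons.
Qed.

(* What maximality gives for a longest path or cycle s: replacing the vertices
   strictly between x and y by d does not make it longer. *)
Definition rigid s := uniq s /\ forall x y d, x \in s -> y \in s ->
  index x s < index y s -> path e x (rcons d y) -> uniq d ->
  {in d, forall z, z \notin s} -> size d + index x s < index y s.

(** The first two clauses turn members into walks around a small separator, as the use of Menger's
    theorem requires; rigidity limits the detours. *)
Definition good_family :=
  [/\ forall Q Q', Q \in F -> Q' \in F -> touches Q Q',
      forall Q x y, Q \in F -> x \in Q -> y \in Q ->
        exists p, [/\ path e x p, last x p = y & {subset x :: p <= Q}] &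
      forall Q, Q \in F -> exists2 s, Q = [set x in s] & rigid s].

Hypothesis gF : good_family.

Lemma tv_mem Q : Q \in F -> tv Q = tv setT.
Proof. by case: gF => h _ _ QF; apply: tv_setT => Q' Q'F; apply: h. Qed.

(** In the graph without Z, a separator with fewer than m vertices would leave members QA touching A
    and QB touching B that avoid both it and Z. These meet, so their union contains a walk from A to
    B, a contradiction. *)
Lemma linkage m A B Z : m + tv Z <= tv A -> m + tv Z <= tv B ->
  exists ls, [/\ size ls = m, disj ls, all (link e A B) ls,
    {in ls, forall l, tight A B l} &
    {in ls, forall l, {in verts l, forall z, z \notin Z}}].
Proof.
case: gF => F_meet F_conn _.
move=> mA mB; pose r u v := [&& e u v, u \notin Z & v \notin Z].
have subrp x p : path r x p -> path e x p by apply: sub_path => u v /and3P[].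
have rp x p : path e x p -> {in x :: p, forall z, z \notin Z} -> path r x p.
  elim: p x => //= y p IHp x /andP[exy pp] nZ; rewrite /r exy !nZ ?inE ?eqxx ?orbT //=.
  by apply: IHp => // z zp; apply: nZ; rewrite inE zp orbT.
have [S sS|ls0 [sz0 al0 dl0]] := @menger _ r (A :\: Z) (B :\: Z) m.
  rewrite leqNgt; apply/negP=> ltS.
  have [|QA [QAF /touchesP[a aQ aA] QAS QAZ]] := @avoid S A Z.
    by apply: leq_trans mA; rewrite -addSn leq_add2r.
  have [|QB [QBF /touchesP[b bQ bB] QBS QBZ]] := @avoid S B Z.
    by apply: leq_trans mB; rewrite -addSn leq_add2r.
  have /touchesP[c cA cB] := F_meet _ _ QAF QBF.
  have [p [pp lp sp]] := F_conn _ _ _ QAF aQ cA.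
  have [q [pq lq sq]] := F_conn _ _ _ QBF cB bQ.
  have outs Q W z : ~~ touches Q W -> z \in Q -> z \notin W.
    by move=> nm zQ; apply: contra nm => zW; apply/touchesP; exists z.
  have inQ z : z \in a :: p ++ q -> z \in QA \/ z \in QB.
    rewrite -cat_cons mem_cat => /orP[/sp|zq]; [by left|right].
    by apply: sq; rewrite inE zq orbT.
  have : has (mem S) (a :: p ++ q).
    apply: sS.
    - by rewrite inE aA (outs _ _ _ QAZ).
    - apply: rp; first by rewrite cat_path pp lp.
      by move=> z /inQ[] zQ; [apply: outs QAZ zQ | apply: outs QBZ zQ].
    - by rewrite last_cat lp lq inE bB (outs _ _ _ QBZ).
  by case/has_setP=> z /inQ[] zQ; apply/negP; [apply: outs QAS zQ | apply: outs QBS zQ].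
have [ls [sz al dl tl]] := trim_all al0 dl0.
have nZ : {in ls, forall l, {in verts l, forall z, z \notin Z}}.
  move=> [x p] /(allP al)/and4P[/= + _ + _]; rewrite inE => /andP[xZ _].
  rewrite /verts /=; elim: p x xZ => [|y p IHp] x xZ /=.
    by move=> _ z; rewrite inE => /eqP->.
  case/andP=> /and3P[_ _ yZ] pp z; rewrite inE => /predU1P[->//|].
  exact: IHp.
exists ls; split; rewrite ?sz //.
- apply: sub_all al => l /and4P[]; rewrite !inE => /andP[_ lA] /andP[_ lB] pl ul.
  by apply/and4P; split=> //; apply: subrp.
- move=> l lls; have [tA tB] := tl l lls; split=> z zl zX.
    by apply: tA => //; rewrite inE zX (nZ l).
  by apply: tB => //; rewrite inE zX (nZ l).
Qed.

Lemma belast_lend l z : uniq (verts l) -> z \in belast l.1 l.2 ->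
  z \in verts l /\ z != lend l.
Proof.
rewrite /verts /lend lastI rcons_uniq mem_rcons inE => /andP[nl _] zl.
by rewrite zl orbT; split=> //; apply: contraNneq nl => <-.
Qed.

(* The detour between two attachments on Q follows two of the disjoint O-Q paths and
   the longer of the two arcs of O between their origins. *)
Lemma sun_bound O Q : 3 <= size O -> uniq O -> cycle e O -> Q \in F ->
  {in O, forall z, z \notin Q} ->
  (tv [set x in O]).-1 * (size O + 4) <= (#|Q|.-1).*2.
Proof.
move=> sz3 uO cO QF nOQ; have [_ _ /(_ Q QF)[s eQ [us rs]]] := gF.
have [||ls [szl dl al tl _]] := @linkage (tv [set x in O]) [set x in O] Q set0.
- by rewrite tv0 addn0.
- by rewrite tv0 addn0 (tv_mem QF) tv_le.
rewrite -szl -(size_map (fun l => index (lend l) s)) => {szl}.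
have lendQ l : l \in ls -> lend l \in s.
  by move=> /(allP al)/and4P[_ + _ _]; rewrite eQ inE.
have fstO l : l \in ls -> l.1 \in O.
  by move=> /(allP al)/and4P[+ _ _ _]; rewrite inE.
have cQ : #|Q| = size s by rewrite eQ cardsE; apply/card_uniqP.
have pl l : l \in ls -> path e l.1 l.2 by move=> /(allP al)/and4P[].
have ul l : l \in ls -> uniq (verts l) by move=> /(allP al)/and4P[].
have sQ z : (z \in Q) = (z \in s) by rewrite eQ inE.
apply: spread_leq.
- rewrite map_inj_in_uniq ?disj_uniq // => l l' lls lls' eqi.
  apply: (disj_inj dl lls lls' (lend_verts l)).
  have -> : lend l = lend l' by rewrite -(nth_index l.1 (lendQ l lls)) eqi nth_index ?lendQ.
  exact: lend_verts.
- move=> _ /mapP[l lls ->]; rewrite cQ -ltnS prednK ?index_mem ?lendQ //.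
  by case: (s) (lendQ l lls).
move=> _ _ /mapP[l lls ->] /mapP[l' lls' ->] ij.
have nll : l != l' by apply: contraTneq ij => ->; rewrite ltnn.
have n1 : l.1 != l'.1.
  apply: contra nll => /eqP n1; apply/eqP.
  by apply: (disj_inj dl lls lls' (fst_verts l)); rewrite n1 fst_verts.
have [m [pm um sm [xm ym] szm]] := long_arc e_sym uO cO (fstO l lls) (fstO l' lls') n1.
pose d := rev (belast l.1 l.2) ++ m ++ belast l'.1 l'.2.
have szp u : u \in ls -> 0 < size (belast u.1 u.2).
  move=> uls; rewrite size_belast; case: u uls => x [|y p] // uls.
  by have := nOQ x (fstO _ uls); rewrite sQ; have := lendQ _ uls; rewrite /lend /= => ->.
have bP u z : u \in ls -> z \in belast u.1 u.2 ->
    [/\ z \in verts u, z \notin Q & z \in O -> z = u.1].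
  move=> uls /(belast_lend (ul u uls))[zu zl]; have [t1 t2] := tl u uls; split=> //.
    by apply: contra zl => zQ; apply/eqP/t2.
  by move=> zO; apply: t1; rewrite ?inE.
have ub u : u \in ls -> uniq (belast u.1 u.2).
  by move=> /ul; rewrite /verts lastI rcons_uniq => /andP[].
have : size d + index (lend l) s < index (lend l') s.
  apply: rs; rewrite ?lendQ //.
  - have := path_join (pl l lls) pm (pl l' lls').
    by rewrite /verts lastI -!cats1 /d !catA.
  - rewrite !cat_uniq rev_uniq !ub // um /= andbT has_cat negb_or -andbA; apply/and3P; split.
    + apply/hasPn=> z zm; rewrite mem_rev; apply/negP=> /(bP l z lls)[_ _ /(_ (sm z zm)) ez].
      by rewrite -ez zm in xm.
    + apply/hasPn=> z /(bP l' z lls')[zl' _ _]; rewrite mem_rev.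
      apply/negP=> /(bP l z lls)[zl _ _]; case/eqP: nll.
      exact: disj_inj dl lls lls' zl zl'.
    + apply/hasPn=> z /(bP l' z lls')[_ _ zO]; apply/negP=> zm.
      by move: ym; rewrite -(zO (sm z zm)) zm.
  - move=> z; rewrite !mem_cat mem_rev -sQ => /or3P[/(bP l z lls)[]//|/sm/nOQ//|].
    by case/(bP l' z lls').
(* The arc has at least [|O|/2 - 1] inner vertices and each link adds at least one vertex off Q.
   With the strict inequality the indices differ by at least [|O|/2 + 2], whence the summand 4. *)
move: (szp l lls) (szp l' lls') szm ij; rewrite !size_cat size_rev; size_lia.
Qed.

End Framework.

Lemma ex_minimal (A : Type) (P : A -> Prop) (f : A -> nat) : (exists a, P a) ->
  exists2 a, P a & forall b, P b -> f a <= f b.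
Proof.
move=> [a Pa]; have [n] := ubnP (f a); elim: n => // n IHn in a Pa *; rewrite ltnS => fan.
have [[b Pb ba]|nex] := pselect (exists2 b, P b & f b < f a).
  by apply: (IHn b) => //; apply: leq_trans fan.
by exists a => // b Pb; rewrite leqNgt; apply/negP=> ba; apply: nex; exists b.
Qed.

(** * The bound in terms of the order *)

Section NatLemmas.

Lemma discrete_ivt (f : nat -> nat) N v : (forall i, f i.+1 <= (f i).+1) ->
  f 0 <= v -> v <= f N -> exists2 p, p <= N & f p = v.
Proof.
move=> fS f0; elim: N => [|N IHN] vf.
  by exists 0 => //; apply/eqP; rewrite eqn_leq f0.
have [/IHN[p pN fp]|lt] := leqP v (f N); first by exists p; rewrite // leqW.
by exists N.+1 => //; apply/eqP; rewrite eqn_leq vf (leq_trans (fS N) lt).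
Qed.

(* Every value of [fun i => minn i.+1 (p - i)] is taken at most twice on [0, p). *)
Lemma depth_sum (t : seq nat) p : uniq t -> {in t, forall i, i < p} ->
  (size t) * (size t).+2 <= 4 * \sum_(i <- t) minn i.+1 (p - i).
Proof.
move=> ut tp; pose f i := minn i.+1 (p - i).
(* Only the first M and the last M positions have depth at most M. *)
have cnt M : count (fun i => f i <= M) t <= M.*2.
  have -> : M.*2 = size (iota 0 M ++ iota (p - M) M) by rewrite size_cat !size_iota addnn.
  rewrite -size_filter; apply: uniq_leq_size; first exact: filter_uniq.
  move=> i; rewrite mem_filter mem_cat !mem_iota => /andP[+ /tp].
  by rewrite /f /=; clear; lia.
(* Depths are truncated at M. Raising M by one adds 1 for each position of depth above M, that is,
   for all but at most 2M of them. *)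
have S M : M * size t <= \sum_(i <- t) minn (f i) M + M * M.-1.
  elim: M => [|M IHM]; first by rewrite mul0n.
  have e : \sum_(i <- t) minn (f i) M.+1 =
     \sum_(i <- t) minn (f i) M + (size t - count (fun i => f i <= M) t).
    rewrite -(count_predC (fun i => f i <= M) t) addKn.
    rewrite -sum1_count [X in _ = _ + X]big_mkcond -big_split.
    apply: eq_bigr => i _ /=; move: (f i) => fi. case: ifP; lia.
  rewrite e; have := cnt M; have := count_size (fun i => f i <= M) t.
  move: IHM; move: (count _ _) (\sum_(i <- t) _) (size t); clear => c x s.
  case: M => [|M] /=; first by lia.
  by rewrite !mulSn !mulnS -!addnn; lia.
(* This M maximizes [M * size t - M * M.-1]. *)
have le : \sum_(i <- t) minn (f i) (uphalf (size t)) <= \sum_(i <- t) f i.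
  by apply: leq_sum => i _; apply: geq_minl.
have := S (uphalf (size t)); move: le.
have := uphalf_half (size t); have := odd_double_half (size t).
rewrite -/f; move: (\sum_(i <- t) f i) (\sum_(i <- t) minn (f i) _) => s1 s2.
move: (size t) (half _) (uphalf _) (odd _) => m h u [] /=; nia.
Qed.

End NatLemmas.

Section Part1.
Variables (T : finType) (e : rel T) (F : {set {set T}}).
Hypothesis e_sym : symmetric e.
Hypothesis gF : good_family e F.
Local Notation tv := (tv F).
Local Notation k := (tv setT).
Local Notation tvs s := (tv [set x in s]).

Definition simple_cycle c := [&& 3 <= size c, cycle e c & uniq c].

(** The distance between positions i and j around a cycle of c vertices. *)
Definition cdist c i j := minn (maxn i j - minn i j) (c - (maxn i j - minn i j)).

Lemma simple_cycle_join x d y m : path e x (rcons d y) -> path e x (rcons m y) ->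
  uniq d -> uniq m -> x != y -> x \notin d -> y \notin d -> x \notin m -> y \notin m ->
  {in d, forall z, z \notin m} -> 0 < size d + size m ->
  simple_cycle (x :: d ++ y :: rev m).
Proof.
move=> pd pm ud um xy xd yd xm ym dm sz; apply/and3P; split.
- by rewrite /= size_cat /= size_rev; move: sz; size_lia.
- rewrite /= rcons_cat /= -cat_rcons cat_path pd last_rcons.
  exact: detour_rev.
- rewrite /= mem_cat inE (negPf xd) (negPf xy) mem_rev (negPf xm) /= cat_uniq ud /=.
  rewrite mem_rev rev_uniq ym um negb_or yd /= andbT; apply/hasPn=> z.
  by rewrite mem_rev => zm; apply/negP=> /dm; rewrite zm.
Qed.

(* A chord splits O into two shorter cycles covering O, one of which has tv at least k/2. *)
Lemma chord_dist O x p : simple_cycle O -> k <= (tvs O).*2 ->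
  (forall O', simple_cycle O' -> k <= (tvs O').*2 -> k <= tvs O' /\ size O <= size O') ->
  path e x p -> x \in O -> last x p \in O ->
  cdist (size O) (index x O) (index (last x p) O) <= size p.
Proof.
move=> scO kO min; have /and3P[sz3 cO uO] := scO.
suff uniq_case n x' p' : size p' < n -> path e x' p' -> uniq (x' :: p') -> x' \in O ->
    last x' p' \in O -> cdist (size O) (index x' O) (index (last x' p') O) <= size p'.
  move=> pp; case/shortenP: pp => p' pp' up' sp' xO yO.
  apply: leq_trans (uniq_case _ x p' (leqnn _) pp' up' xO yO) _.
  by apply: uniq_leq_size; first by case/andP: up'.
elim: n x' p' => // n IHn {}x {}p pn pp up xO yO.
have ixl z : z \in O -> index z O < size O by rewrite index_mem.
have [eyx|nyx] := eqVneq (last x p) x; first by rewrite eyx /cdist; size_lia.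
case/lastP: p => [|d y] in pn pp up yO nyx *; first by rewrite eqxx in nyx.
rewrite last_rcons in yO nyx *; rewrite size_rcons in pn *.
(* A path with an inner vertex w on O is split at w, and the triangle inequality for [cdist]
   combines the two pieces. *)
have [/hasP[w wd wO]|/hasPn nd] := boolP (has (mem O) d).
  case/path.splitPr: wd pn pp up => d1 d2.
  rewrite -cat_rcons rcons_cat cat_path last_rcons => pn /andP[p1 p2].
  rewrite -cat_cons cat_uniq => /and3P[u1 h12 u2].
  have le1 : cdist (size O) (index x O) (index w O) <= size (rcons d1 w).
    rewrite -{1}(last_rcons x d1 w); apply: IHn; rewrite ?last_rcons //.
    by move: pn; rewrite size_cat size_rcons; size_lia.
  have le2 : cdist (size O) (index w O) (index y O) <= size (rcons d2 y).
    rewrite -{1}(last_rcons w d2 y); apply: IHn; rewrite ?last_rcons //.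
      by move: pn; rewrite size_cat !size_rcons; size_lia.
    rewrite cons_uniq u2 andbT; apply/negP=> wd2; case/negP: h12; apply/hasP.
    by exists w => //; rewrite -rcons_cons; rewrite inE mem_rcons mem_head orbT.
  move: le1 le2 (ixl x xO) (ixl y yO) (ixl w wO).
  by rewrite size_cat !size_rcons /cdist; size_lia.
(* From here on d is a shortcut off O: replacing either arc of O by it gives a cycle shorter than
   O. *)
rewrite leqNgt; apply/negP=> lt.
have xy : x != y by rewrite eq_sym.
have [] := arcs e_sym uO cO xO yO xy.
set lo := minn _ _; set hi := maxn _ _.
move=> [m1 [p1 u1] [h1 s1]] [m2 [p2 u2] [h2 s2]].
have [xd ud yd] : [/\ x \notin d, uniq d & y \notin d].
  by move: up; rewrite cons_uniq mem_rcons inE negb_or rcons_uniq => /and3P[/andP[_ ->] -> ->].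
have ilt : lo <= index x O <= hi /\ lo <= index y O <= hi by rewrite /lo /hi; clear; lia.
have [xm1 ym1 xm2 ym2] : [/\ x \notin m1, y \notin m1, x \notin m2 & y \notin m2].
  rewrite !h1 !h2 xO yO; move: ilt => [] /=.
  by rewrite /lo /hi; move: (index x O) (index y O); clear => i j; split; lia.
have n1 : {in d, forall z, z \notin m1}.
  by move=> z zd; rewrite h1 negb_and (nd z zd).
have n2 : {in d, forall z, z \notin m2}.
  by move=> z zd; rewrite h2 negb_and (nd z zd).
have lts : size d < (hi - lo).-1 /\ size d < size m2.
  by move: lt s2; rewrite /cdist -/lo -/hi; size_lia.
have sc1 : simple_cycle (x :: d ++ y :: rev m1).
  by apply: simple_cycle_join => //; move: lts s1; size_lia.
have sc2 : simple_cycle (x :: d ++ y :: rev m2).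
  by apply: simple_cycle_join => //; move: lts s1; size_lia.
have sum : k <= tvs (x :: d ++ y :: rev m1) + tvs (x :: d ++ y :: rev m2).
  (* O satisfies its own minimality condition, which yields [k <= tvs O]. *)
  have [kO' _] := min O scO kO; apply: leq_trans kO' _; apply: tv_cover.
  apply/subsetP=> z; rewrite !inE => zO; rewrite !mem_cat !inE !mem_rev h1 h2 zO /=.
  have [->|zx] := eqVneq z x; first by [].
  have [->|zy] := eqVneq z y; first by rewrite !orbT.
  have [ezx ezy] : index z O <> index x O /\ index z O <> index y O.
    split=> ei; first by case/eqP: zx; rewrite -(nth_index x zO) ei nth_index.
    by case/eqP: zy; rewrite -(nth_index x zO) ei nth_index.
  rewrite /= -orbA; move: ezx ezy; rewrite /lo /hi; move: (index _ _) (index _ _) (index _ _).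
  by clear => i j l; case: (z \in d) => //=; lia.
have small m : size m < size O - (size d).+2 -> ~~ (k <= (tvs (x :: d ++ y :: rev m)).*2) \/
   ~ simple_cycle (x :: d ++ y :: rev m).
  move=> sm; case: (boolP (k <= _)) => [km|_]; [right=> sc | by left].
  have [_] := min _ sc km; move: sm; rewrite /= size_cat /= size_rev; size_lia.
have sz1 : size m1 < size O - (size d).+2 by move: lts s1 s2; size_lia.
have sz2 : size m2 < size O - (size d).+2 by move: lts s1 s2; size_lia.
case: (small m1 sz1) (small m2 sz2) => [k1|/(_ sc1)//] [k2|/(_ sc2)//].
by move: sum k1 k2; move: (tvs _) (tvs _) k => a b c; clear; lia.
Qed.

Lemma tv_rcons s x : tvs (rcons s x) <= (tvs s).+1.
Proof.
rewrite -addn1; apply: leq_trans (_ : tvs s + tv [set x] <= _).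
  by apply: tv_cover; apply/subsetP=> z; rewrite !inE mem_rcons inE orbC.
by rewrite leq_add2l (leq_trans (tv_card _ _)) ?cards1.
Qed.

Lemma tv_take_step s i : tvs (take i.+1 s) <= (tvs (take i s)).+1.
Proof.
case: (ltnP i (size s)) => [lt|ge]; last by rewrite !take_oversize ?(leqW ge).
case: s lt => // x s lt; by rewrite (take_nth x) // tv_rcons.
Qed.

Lemma disj_size (ls : seq (T * seq T)) : disj ls -> \sum_(l <- ls) size (verts l) <= #|T|.
Proof.
move=> dl; have -> : \sum_(l <- ls) size (verts l) = size (flatten (map (@verts T) ls)).
  by rewrite size_flatten sumnE /shape -map_comp big_map.
by rewrite -(card_uniqP dl) max_card.
Qed.

Theorem tv_square_le_order :
  (exists2 c, simple_cycle c & k <= (tvs c).*2) -> k * k <= 8 * #|T|.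
Proof.
move=> exc; rewrite leqNgt; apply/negP=> ltk.
(* If Q were missed, [sun_bound] together with [tvs O <= size O] and [#|Q| + size O <= #|T|] would
   give [k * k <= 8 * #|T|]. *)
have dich O : simple_cycle O -> k <= (tvs O).*2 -> tvs O = k.
  move=> /and3P[sz3 cO uO] kO; apply: tv_setT => Q QF.
  apply: contrapT => /negP nm.
  have nOQ : {in O, forall z, z \notin Q}.
    by move=> z zO; apply: contra nm => zQ; apply/touchesP; exists z; rewrite ?inE.
  have := sun_bound e_sym gF sz3 uO cO QF nOQ.
  have leO : tvs O <= size O.
    by apply: leq_trans (tv_card _ _) _; rewrite cardsE; apply: card_size.
  have : #|Q| + size O <= #|T|.
    have <- : #|[set x in O]| = size O by rewrite cardsE; apply/card_uniqP.
    have -> : #|Q| + #|[set x in O]| = #|Q :|: [set x in O]|.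
      rewrite cardsU (_ : Q :&: _ = set0) ?cards0 ?subn0 //; apply/setP=> z.
      rewrite !inE; by apply/negP=> /andP[zQ /nOQ]; rewrite zQ.
    exact: max_card.
  move: leO sz3 ltk kO; move: (tvs O) (tv setT) => t k'; rewrite -muln2.
  move: (size O) #|Q| #|T| => c q n; clear; nia.
have [|O [scO kO] minO] := @ex_minimal _ (fun c => simple_cycle c /\ k <= (tvs c).*2) size.
  by case: exc => c; exists c.
have /and3P[sz3 cO uO] := scO.
have tO := dich O scO kO.
have kc : k <= size O.
  by rewrite -tO; apply: leq_trans (tv_card _ _) _; rewrite cardsE; apply: card_size.
(* O is cut where its initial segment weighs exactly [uphalf k], which is possible since one more
   vertex raises the weight by at most one. The rest weighs at least [k./2]. *)
have [||p pO tp] := @discrete_ivt (fun i => tvs (take i O)) (size O) (uphalf k) (tv_take_step O).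
- by rewrite take0 (_ : [set x in [::]] = set0) ?tv0 //; apply/setP=> z; rewrite !inE.
- by rewrite take_size tO uphalfE; clear; lia.
set X := [set x in take p O] in tp; pose Y := [set x in drop p O].
have kXY : k <= uphalf k + tv Y.
  rewrite -{1}tO -tp; apply: tv_cover; apply/subsetP=> z.
  by rewrite !inE -mem_cat cat_take_drop.
have [||ls [szl dl al _ _]] := @linkage _ _ _ gF k./2 X Y set0.
- by rewrite tv0 addn0 tp uphalfE; clear; lia.
- by rewrite tv0 addn0; move: kXY; rewrite uphalfE; clear; lia.
have iX l : l \in ls -> [/\ l.1 \in O, index l.1 O < p & uniq (verts l)].
  move=> /(allP al)/and4P[+ _ _ ul]; rewrite inE => lX; have lO := mem_take lX.
  by rewrite -in_take.
have iY l : l \in ls -> [/\ lend l \in O, p <= index (lend l) O & path e l.1 l.2].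
  move=> /(allP al)/and4P[_ + pl _]; rewrite inE => lY; have lO := mem_drop lY.
  split=> //; rewrite leqNgt; apply/negP; rewrite -in_take // => lX.
  have := uO; rewrite -(cat_take_drop p O) cat_uniq => /and3P[_ /hasPn/(_ _ lY)].
  by rewrite /= lX.
have minO' O' : simple_cycle O' -> k <= (tvs O').*2 -> k <= tvs O' /\ size O <= size O'.
  by move=> sc kO'; split; [rewrite (dich O') | apply: minO].
pose f1 (l : T * seq T) := index l.1 O; pose f2 (l : T * seq T) := index (lend l) O - p.
have jO l : l \in ls -> index (lend l) O < size O.
  by move=> lls; rewrite index_mem; case: (iY l lls).
(* Either way round O, going from one end of the link to the other leaves the first arc and enters
   the second, so the distance is at least the sum of the two depths minus one; the link has one
   more vertex than edges. *)
have szl1 l : l \in ls -> minn (f1 l).+1 (p - f1 l) + minn (f2 l).+1 (size O - p - f2 l) <=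
   size (verts l).
  move=> lls; have [lO ip _] := iX l lls; have [lO' jp pl] := iY l lls.
  have := chord_dist scO kO minO' pl lO lO'.
  have -> : size (verts l) = (size l.2).+1 by [].
  move: ip jp (jO l lls); rewrite /cdist /f1 /f2 -/(lend l).
  move: (index _ _) (index _ _); size_lia.
have uls := disj_uniq dl.
have d1 : k./2 * k./2.+2 <= 4 * \sum_(l <- ls) minn (f1 l).+1 (p - f1 l).
  have := @depth_sum (map f1 ls) p; rewrite size_map szl big_map; apply; last first.
    by move=> _ /mapP[l lls ->]; have [] := iX l lls.
  rewrite map_inj_in_uniq // => l l' lls lls' eqf.
  have [lO _ _] := iX l lls; have [lO' _ _] := iX l' lls'.
  apply: (disj_inj dl lls lls' (fst_verts l)).
  by rewrite -(nth_index l.1 lO) -/(f1 l) eqf nth_index // fst_verts.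
have d2 : k./2 * k./2.+2 <= 4 * \sum_(l <- ls) minn (f2 l).+1 (size O - p - f2 l).
  have := @depth_sum (map f2 ls) (size O - p); rewrite size_map szl big_map; apply; last first.
    move=> _ /mapP[l lls ->]; have [_ jp _] := iY l lls; have := jO l lls.
    by rewrite /f2; move: jp; size_lia.
  rewrite map_inj_in_uniq // => l l' lls lls' eqf.
  have [lO jp _] := iY l lls; have [lO' jp' _] := iY l' lls'.
  have eqi : index (lend l) O = index (lend l') O by move: eqf jp jp'; rewrite /f2; size_lia.
  apply: (disj_inj dl lls lls' (lend_verts l)).
  by rewrite -(nth_index l.1 lO) eqi nth_index // lend_verts.
have : \sum_(l <- ls) (minn (f1 l).+1 (p - f1 l) + minn (f2 l).+1 (size O - p - f2 l)) <= #|T|.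
  apply: leq_trans (disj_size dl).
  by rewrite big_seq [X in _ <= X]big_seq; apply: leq_sum.
(* For [m = k./2], the surplus of [m * m.+2] over [m * m] pays for rounding k down to an even
   number. *)
rewrite big_split /=; move: d1 d2 ltk kc sz3 pO; move: (\sum_(l <- ls) _) (\sum_(l <- ls) _).
have := odd_double_half k; have := max_card [set x in O].
rewrite cardsE (card_uniqP uO); move: #|T| (size O) k (k./2) (odd k) => n c k' m b.
by clear; case: b => /=; nia.
Qed.
End Part1.

(** * Closing paths into cycles along a line *)

Section Chains.
Variables (T : finType) (e : rel T) (F : {set {set T}}) (L0 theta : nat).
Hypothesis e_sym : symmetric e.
Hypothesis theta3 : 3 <= theta.
Local Notation tv := (tv F).
Local Notation tvs s := (tv [set x in s]).
Implicit Types (L s : seq T) (c : seq T * nat) (cs : seq (seq T * nat)).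

(* A pair (c, n) is a path or cycle c that is made of n of the original rows. *)
Definition heavy c := [&& 0 < c.2, L0 * c.2 <= size c.1 & theta <= tvs c.1].

Definition vfam cs := flatten (map fst cs).

Definition chain L c := [/\ heavy c, sorted e c.1 &
  exists x p y, [/\ c.1 = x :: rcons p y, x \in L, y \in L &
    {in p, forall z, z \notin L}]].

Definition chains L cs := uniq (vfam cs) /\ {in cs, forall c, chain L c}.

Lemma tvs_sub s s' : {subset s <= s'} -> tvs s <= tvs s'.
Proof. by move=> ss; apply/tvS/subsetP=> z; rewrite !inE; apply: ss. Qed.

Lemma tvs_size s : tvs s <= size s.
Proof. by apply: leq_trans (tv_card _ _) _; rewrite cardsE; apply: card_size. Qed.

Lemma perm_vfam cs cs' : perm_eq cs cs' -> perm_eq (vfam cs) (vfam cs').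
Proof. by move=> pcs; apply/perm_flatten/perm_map. Qed.

Lemma mem_vfam cs z : reflect (exists2 c, c \in cs & z \in c.1) (z \in vfam cs).
Proof.
apply: (iffP flattenP) => [[_ /mapP[c ccs ->] zc]|[c ccs zc]]; first by exists c.
by exists c.1 => //; apply: map_f.
Qed.

Lemma sorted_rev s : sorted e s -> sorted e (rev s).
Proof. by case: s => // x p /(path_rev e_sym); rewrite lastI rev_rcons. Qed.

Lemma chain_rev L c : chain L c -> chain L (rev c.1, c.2).
Proof.
move=> [/and3P[c0 sz tc] sc [x [p [y [ec xL yL pL]]]]]; split=> /=.
- rewrite /heavy /= c0 size_rev sz (leq_trans tc) //.
  by apply: tvs_sub => z; rewrite mem_rev.
- exact: sorted_rev.
- exists y, (rev p), x; split=> //; first by rewrite ec rev_cons rev_rcons.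
  by move=> z; rewrite mem_rev; apply: pL.
Qed.

(** Inner vertices of a chain are off L, so u is an end of its chain, and reversal makes it the
    first vertex. *)
Lemma chains_front L cs u : chains L cs -> u \in L -> u \in vfam cs ->
  exists c cs', [/\ chains L (c :: cs'), exists p, c.1 = u :: p,
    \sum_(c <- c :: cs') c.2 = \sum_(c <- cs) c.2 & vfam (c :: cs') =i vfam cs].
Proof.
move=> [ucs ccs] uL /mem_vfam[c cin uc].
have pe := perm_to_rem cin.
have chr c' : c' \in rem c cs -> chain L c' by move/mem_rem; apply: ccs.
have [hc sc [x [p [y [ec xL yL pL]]]]] := ccs c cin.
have upe : uniq (vfam (c :: rem c cs)) by rewrite -(perm_uniq (perm_vfam pe)).
have pr : perm_eq (vfam ((rev c.1, c.2) :: rem c cs)) (vfam (c :: rem c cs)).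
  by rewrite /vfam /= perm_cat2r perm_rev.
have /orP[/eqP eux|/eqP euy] : (u == x) || (u == y).
  move: uc; rewrite ec inE mem_rcons inE => /or3P[->//|->|]; first by rewrite orbT.
  by move=> /pL; rewrite uL.
- exists c, (rem c cs); split.
  + by split=> // c'; rewrite inE => /predU1P[->|/chr//]; apply: ccs.
  + by exists (rcons p y); rewrite ec eux.
  + by rewrite -(perm_big _ pe).
  + by move=> z; rewrite (perm_mem (perm_vfam pe)).
- exists (rev c.1, c.2), (rem c cs); split.
  + split; last first.
      by move=> c'; rewrite inE => /predU1P[->|/chr//]; apply/chain_rev/ccs.
    by rewrite (perm_uniq pr).
  + by exists (rev (x :: p)); rewrite ec -rcons_cons rev_rcons euy.
  + by rewrite (perm_big _ pe) !big_cons.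
  + by move=> z; rewrite (perm_mem (perm_vfam pe)) (perm_mem pr).
Qed.

(* Sweep along the line L: a chain ending at the head u of L is closed if its other end
   is the next vertex w, joined to the chain ending at w if there is one, and otherwise
   prolonged to w. *)
Lemma close_chains L cs : uniq L -> sorted e L -> chains L cs ->
  exists fam, [/\ uniq (vfam fam), {in fam, forall c, heavy c /\ simple_cycle e c.1},
    \sum_(c <- fam) c.2 = \sum_(c <- cs) c.2 & {subset vfam fam <= vfam cs ++ L}].
Proof.
have [n] := ubnP (size L); elim: n => // n IHn in L cs *.
case: L => [|u L] szL uL sL ch.
  case: cs ch => [|c cs] [_ ccs]; first by exists [::]; split.
  by have [_ _ [x [p [y []]]]] := ccs c (mem_head _ _).
have sL' : sorted e L by move: sL => /=; apply: path_sorted.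
have [unL uL'] := andP uL.
(* A head that lies on no chain is simply dropped from the line. *)
have [uc|nuc] := boolP (u \in vfam cs); last first.
  have [|fam [uf hf sf subf]] := IHn L cs szL uL' sL'.
    split; first by case: ch.
    move=> c ccs; have [_ /(_ c ccs)[hc sc [x [p [y [ec xL yL pL]]]]]] := ch.
    have nu z : z \in c.1 -> z != u.
      by move=> zc; apply: contraNneq nuc => <-; apply/mem_vfam; exists c.
    split=> //; exists x, p, y; split=> //.
    - by move: xL; rewrite inE (negPf (nu x _)) // ec mem_head.
    - by move: yL; rewrite inE (negPf (nu y _)) // ec inE mem_rcons mem_head orbT.
    - by move=> z /pL; rewrite inE negb_or => /andP[].
  exists fam; split=> // z /subf; rewrite !mem_cat inE => /orP[->//|->].
  by rewrite !orbT.
have [c [cs' [[ucs ccs] [p0 ec0] <- eqv]]] := chains_front ch (mem_head _ _) uc.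
have [hc sc [x [p [y [ec xL yL pL]]]]] := ccs c (mem_head _ _).
have eux : u = x by move: ec; rewrite ec0 => -[].
rewrite -{x}eux in ec xL *; have {xL} := ec0.
move: ucs; rewrite /vfam /= cat_uniq => /and3P[uc1 /hasPn dis ucs'] _.
have [yu up] : y != u /\ u \notin p.
  move: uc1; rewrite ec /= mem_rcons inE negb_or => /andP[/andP[nuy ->] _].
  by rewrite eq_sym.
case: L => [|w L] in szL uL sL ch sL' unL uL' yL pL ccs *.
  by move: yL; rewrite inE (negPf yu).
have euw : e u w by move: sL => /= /andP[].
have sL2 : sorted e L by move: sL' => /=; apply: path_sorted.
have [wL uL2] := andP uL'.
have [nuw nuL] : u != w /\ u \notin L by move: unL; rewrite inE negb_or => /andP[].
have szL2 : size L < n by move: szL => /=; size_lia.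
have szL1 : size (w :: L) < n by move: szL => /=; size_lia.
have memL z : z \in u :: w :: L -> z != u -> z != w -> z \in L.
  by rewrite !inE => /or3P[/eqP->|/eqP->|//]; rewrite eqxx.
have csP c' : c' \in cs' -> chain [:: u, w & L] c' /\ u \notin c'.1.
  move=> c'cs; split; first by apply: ccs; rewrite inE c'cs orbT.
  apply/negP=> uc'; have /dis/negP[] : u \in vfam cs' by apply/mem_vfam; exists c'.
  by rewrite ec0 mem_head.
(* A chain avoiding u and w has both ends further down the line. *)
have shrink c' : chain [:: u, w & L] c' -> u \notin c'.1 -> w \notin c'.1 -> chain L c'.
  move=> [hc' sc' [x' [p' [y' [ec' xL' yL' pL']]]]] uc' wc'.
  have nz z : z \in c'.1 -> z != u /\ z != w.
    by move=> zc; split; [apply: contraNneq uc' | apply: contraNneq wc'] => <-.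
  have [|x'u x'w] := nz x'; first by rewrite ec' mem_head.
  have [|y'u y'w] := nz y'; first by rewrite ec' inE mem_rcons mem_head orbT.
  split=> //; exists x', p', y'; split=> //; try exact: memL.
  by move=> z /pL'; rewrite !inE !negb_or => /and3P[].
have yL' : y != w -> y \in L by apply: memL.
have pL2 : {in p, forall z, z \notin L /\ z != w}.
  by move=> z /pL; rewrite !inE !negb_or => /and3P[_ -> ->].
(* Here the edge uw closes the chain into a cycle, and both vertices leave the line. *)
have [eyw|nyw] := eqVneq y w.
  have nwcs c' : c' \in cs' -> w \notin c'.1.
    move=> c'cs; apply/negP=> wc'; have /dis/negP[] : w \in vfam cs'.
      by apply/mem_vfam; exists c'.
    by rewrite /= ec -eyw inE mem_rcons mem_head orbT.
  have [|fam [uf hf sf subf]] := IHn L cs' szL2 uL2 sL2.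
    by split=> // c' c'cs; have [? ?] := csP c' c'cs; apply: shrink => //; apply: nwcs.
  exists (c :: fam); split.
  - rewrite /vfam /= cat_uniq uc1 uf andbT; apply/hasPn=> z /subf.
    rewrite mem_cat => /orP[/dis//|zL]; apply/negP; rewrite /= ec inE mem_rcons inE.
    case/or3P=> [/eqP ezu|/eqP ezy|/pL2[]]; last by rewrite zL.
      by rewrite -ezu zL in nuL.
    by rewrite -eyw -ezy zL in wL.
  - move=> c'; rewrite inE => /predU1P[->|]; last exact: hf.
    split=> //; apply/and3P; split=> //.
      (* A weight of at least 3 guarantees the three vertices that a cycle needs. *)
      case/and3P: hc => _ _ h; apply: leq_trans theta3 _.
      exact: leq_trans h (tvs_size _).
    rewrite ec /= rcons_path last_rcons -eyw in euw *; rewrite e_sym euw andbT.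
    by move: sc; rewrite ec.
  - by rewrite !big_cons sf.
  - move=> z; rewrite /vfam /= mem_cat => /orP[zc|/subf].
      by rewrite mem_cat -eqv /vfam /= mem_cat zc.
    rewrite !mem_cat -eqv /vfam /= mem_cat => /orP[->|zL]; first by rewrite orbT.
    by rewrite !inE zL !orbT.
have wc : w \notin c.1.
  rewrite ec inE mem_rcons inE negb_or eq_sym nuw /= negb_or eq_sym nyw /=.
  by apply/negP=> /pL2[_]; rewrite eqxx.
have [wcs|nwcs] := boolP (w \in vfam cs'); last first.
  have [|fam [uf hf sf subf]] := IHn (w :: L) ((w :: c.1, c.2) :: cs') szL1 uL' sL'.
    split.
      rewrite -[vfam _]/((w :: c.1) ++ vfam cs') cat_uniq.
      apply/and3P; split=> //; first by rewrite cons_uniq wc.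
      apply/hasPn=> z zcs; rewrite inE negb_or (dis z zcs) andbT.
      by apply: contraNneq nwcs => <-.
    move=> c'; rewrite inE => /predU1P[->|c'cs].
      split=> /=.
      + case/and3P: hc => c0 szc tc; apply/and3P; split; rewrite //= ?leqW //.
        by apply: leq_trans tc _; apply: tvs_sub => z; rewrite inE => ->; rewrite orbT.
      + by rewrite ec /= e_sym euw; move: sc; rewrite ec.
      + exists w, (u :: p), y; rewrite ec mem_head inE yL' ?orbT //; split=> // z.
        rewrite inE => /predU1P[->|]; first by rewrite inE negb_or nuw.
        by case/pL2=> zL zw; rewrite inE negb_or zw.
    have wc' : w \notin c'.1 by apply: contra nwcs => wc'; apply/mem_vfam; exists c'.
    have [ch' uc'] := csP c' c'cs.
    have [hc' sc' [x' [p' [y' [ec' xL' yL2 pL']]]]] := shrink c' ch' uc' wc'.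
    split=> //; exists x', p', y'; split=> //; rewrite ?inE ?xL' ?yL2 ?orbT // => z zp.
    rewrite inE negb_or pL' // andbT; apply: contraNneq wc' => <-.
    by rewrite ec' inE mem_rcons inE zp !orbT.
  exists fam; split=> //; first by rewrite sf !big_cons.
  move=> z /subf; rewrite !mem_cat -eqv /vfam /= !mem_cat !inE.
  by case/orP=> [/orP[/orP[]|]|/orP[]] ->; rewrite ?orbT.
have ch2 : chains [:: u, w & L] cs'.
  by split=> // c' c'cs; apply: ccs; rewrite inE c'cs orbT.
have wLL : w \in [:: u, w & L] by rewrite !inE eqxx orbT.
have [c2 [cs2 [[ucs2 ccs2] [p2 ec2] s2 eqv2]]] := chains_front ch2 wLL wcs.
have [hc2 sc2 [x2 [q2 [y2 [ec2' x2L y2L p2L]]]]] := ccs2 c2 (mem_head _ _).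
have ewx : w = x2 by move: ec2'; rewrite ec2 => -[].
rewrite -{x2}ewx in ec2' x2L; have c2cs z : z \in c2.1 -> z \in vfam cs'.
  by rewrite -eqv2 /vfam /= mem_cat => ->.
move: ucs2; rewrite /vfam /= cat_uniq => /and3P[uc2 /hasPn dis2 ucs2].
have y2w : y2 != w.
  by move: uc2; rewrite ec2' /= mem_rcons inE negb_or eq_sym => /andP[/andP[]].
have y2u : y2 != u.
  have : y2 \in c2.1 by rewrite ec2' inE mem_rcons mem_head orbT.
  by move/c2cs/dis; apply: contraNneq => ->; rewrite /= ec0 mem_head.
have cs2cs z : z \in vfam cs2 -> z \in vfam cs'.
  by rewrite -eqv2 /vfam /= mem_cat orbC => ->.
have uc2' : u \notin c2.1.
  apply/negP=> /c2cs/dis/negP[]; by rewrite /= ec0 mem_head.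
(* The edge uw joins the two chains. As u and w become inner vertices, both leave the line, and the
   numbers of rows add up. *)
pose c3 := (rev c2.1 ++ c.1, c2.2 + c.2).
have [|fam [uf hf sf subf]] := IHn L (c3 :: cs2) szL2 uL2 sL2.
  split.
    rewrite -[vfam _]/((rev c2.1 ++ c.1) ++ vfam cs2) -catA.
    rewrite cat_uniq rev_uniq; apply/and3P; split=> //.
      apply/hasPn=> z; rewrite mem_cat /= mem_rev => /orP[zc|/dis2//].
      by apply/negP=> /c2cs/dis/negP[].
    rewrite cat_uniq uc1 ucs2 andbT; apply/hasPn=> z.
    by move/cs2cs/dis.
  move=> c'; rewrite inE => /predU1P[->|c'cs].
    split=> /=.
    + case/and3P: hc hc2 => c0 szc tc /and3P[c20 szc2 tc2]; apply/and3P; split=> /=.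
      * by rewrite addn_gt0 c0 orbT.
      * by rewrite mulnDr size_cat size_rev leq_add.
      * by apply: leq_trans tc _; apply: tvs_sub => z; rewrite mem_cat => ->; rewrite orbT.
    + have := sorted_rev sc2; rewrite ec2' rev_cons ec cat_rcons -cat_rcons => s3.
      rewrite cat_rcons; case E: (rev _) s3 => [|z r] /=; first by move: sc; rewrite ec /= e_sym euw.
      by rewrite rcons_path cat_path /= => /andP[-> ->]; rewrite e_sym euw; move: sc; rewrite ec.
    + exists y2, (rev q2 ++ w :: u :: p), y; rewrite ec ec2' rev_cons rev_rcons yL' //.
      split=> //; [by rewrite /= cat_rcons rcons_cat | exact: memL | move=> z].
      rewrite mem_cat mem_rev !inE => /orP[/p2L|/or3P[/eqP->//|/eqP->//|/pL2[]//]].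
      by rewrite !inE !negb_or => /and3P[].
  have inc z : z \in c'.1 -> z \in vfam cs2 by move=> zc; apply/mem_vfam; exists c'.
  apply: shrink; first by apply: ccs2; rewrite inE c'cs orbT.
    by apply/negP=> /inc/cs2cs/dis/negP[]; rewrite /= ec0 mem_head.
  by apply/negP=> /inc/dis2/negP[]; rewrite /= ec2 mem_head.
exists fam; split=> //; first by rewrite sf !big_cons -s2 big_cons addnCA addnA.
move=> z /subf; rewrite !mem_cat -eqv /vfam /= !mem_cat !inE mem_rev.
by case/orP=> [/orP[/orP[/c2cs|]|/cs2cs]|] ->; rewrite ?orbT.
Qed.
End Chains.

(** * Merging transversal cycles *)

Section MergeBound.
Import Order.TTheory GRing.Theory Num.Theory.
Local Open Scope ring_scope.
Variable R : rcfType.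
Implicit Types L a b NA NB A B : nat.

(** Twice the number of vertices wanted in a cycle made of n rows. The excess of sqrt a + sqrt b
    over sqrt (a + b) pays for the vertices lost in a merge. *)
Definition weight L n : R := L%:R * (n%:R + Num.sqrt n%:R).

(** Losing d vertices keeps at least the fraction 1 - 1/N of A, while w - u is at most that fraction
    of w. *)
Lemma keep_fraction (L N A d w u : R) : 0 <= L -> 0 < N -> 0 <= w -> N * d <= A -> 1 <= N ->
  L * w <= 2 * A -> w <= N * u -> L * (w - u) <= 2 * (A - d).
Proof.
move=> L0 N0 w0 Nd N1 LA wu.
rewrite -(ler_pM2l N0).
have h1 : 2 * (N - 1) * A <= 2 * N * (A - d) by nra.
have h2 : L * w * (N - 1) <= 2 * A * (N - 1) by apply: ler_wpM2r; lra.
have h3 : L * w <= L * (N * u) by apply: ler_wpM2l.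
nra.
Qed.

(* The two cycles lose at most the fractions 1/NA and 1/NB of their vertices, which costs
   at most sqrt a / 2, while sqrt a + sqrt b - sqrt (a + b) is at least sqrt a / 2. *)
Lemma merge_bound L a b NA NB m A B dA dB M : (0 < a <= b)%N ->
  (64 * a <= NA * NA)%N -> (NA.-1 * NA.-1 < 64 * a)%N -> (288 * b <= m)%N ->
  (m <= 4 * NA * NB)%N -> (NA * dA <= A)%N -> (NB * dB <= B)%N -> (A + B <= M + dA + dB)%N ->
  weight L a <= 2 * A%:R -> weight L b <= 2 * B%:R -> weight L (a + b) <= 2 * M%:R.
Proof.
move=> /andP[a0 ab] aN Na bm mN dAA dBB AB.
have NA0 : (0 < NA)%N by case: NA aN {Na mN dAA} => //; lia.
have NB0 : (0 < NB)%N by case: NB mN {dBB} => //; lia.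
rewrite /weight; set x := Num.sqrt a%:R; set y := Num.sqrt b%:R; set z := Num.sqrt _.
have x2 : x * x = a%:R by rewrite -expr2 sqr_sqrtr.
have y2 : y * y = b%:R by rewrite -expr2 sqr_sqrtr.
have z2 : z * z = (a + b)%:R by rewrite -expr2 sqr_sqrtr.
have x0 : 0 <= x by exact: sqrtr_ge0.
have y0 : 0 <= y by exact: sqrtr_ge0.
have z0 : 0 <= z by exact: sqrtr_ge0.
have xy : x <= y by rewrite ler_wsqrtr // ler_nat.
have x1 : 1 <= x by rewrite -[1]sqrtr1 ler_wsqrtr // ler1n.
have L0 : 0 <= L%:R :> R by [].
have RNA : 1 <= NA%:R :> R by rewrite ler1n.
have RNB : 1 <= NB%:R :> R by rewrite ler1n.
have RaN : 64 * (x * x) <= NA%:R * NA%:R by rewrite x2 -!natrM ler_nat.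
have RNa : (NA%:R - 1) * (NA%:R - 1) <= 64 * (x * x).
  rewrite x2 -[X in _ - X]/(1%:R) -natrB // subn1 -!natrM ler_nat; exact: ltnW.
have Rbm : 288 * (y * y) <= 4 * NA%:R * NB%:R.
  by rewrite y2 -!natrM ler_nat; apply: leq_trans bm mN.
have RdA : NA%:R * dA%:R <= A%:R :> R by rewrite -natrM ler_nat.
have RdB : NB%:R * dB%:R <= B%:R :> R by rewrite -natrM ler_nat.
have RAB : A%:R + B%:R <= M%:R + dA%:R + dB%:R :> R by rewrite -!natrD ler_nat.
rewrite natrD -x2 -y2 => wA wB.
have N8 : 8 * x <= NA%:R by nra.
have N9 : NA%:R <= 9 * x by nra.
(* Squaring reduces this to 3/4 x^2 <= x y, which holds because a <= b. *)
have zle : z <= y + x / 2 by move: z2; rewrite natrD -x2 -y2; nra.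
have NBx : 8 * (y * y) <= NB%:R * x by nra.
(* As x and y are at least 1, a count plus its root is at most twice the count; the fractions 1/NA
   and 1/NB of these are each at most x / 4. *)
have kA : L%:R * (x * x + x - x / 4) <= 2 * (A%:R - dA%:R).
  by apply: (@keep_fraction _ NA%:R) => //; nra.
have kB : L%:R * (y * y + y - x / 4) <= 2 * (B%:R - dB%:R).
  by apply: (@keep_fraction _ NB%:R) => //; nra.
have : L%:R * (x * x + y * y + z) <= L%:R * (x * x + x - x / 4) + L%:R * (y * y + y - x / 4).
  by rewrite -mulrDr; apply: ler_wpM2l => //; lra.
lra.
Qed.

End MergeBound.

(** * Pigeonhole for classes of consecutive indices *)

Lemma pigeon3 (I : eqType) (s : seq I) (phi f : I -> nat) N : uniq s ->
  {in s, forall x, phi x < N} -> N.*2 < size s -> {in s &, injective f} ->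
  exists x1 x2 x3, [/\ [/\ x1 \in s, x2 \in s & x3 \in s], phi x1 = phi x2, phi x2 = phi x3,
    f x1 < f x2 & f x2 < f x3].
Proof.
elim: N => [|N IHN] in s *; first by case: s => //= x s _ /(_ x (mem_head _ _)).
move=> us sN szs fI; pose P x := phi x == N.
have [c2|c3] := leqP (count P s) 2.
  have [||||x1 [x2 [x3 [[]]]]] := IHN (filter (predC P) s).
  - exact: filter_uniq.
  - by move=> x; rewrite mem_filter /= /P => /andP[xN /sN]; rewrite ltnS leq_eqVlt (negPf xN).
  - by rewrite size_filter; move: szs (count_predC P s); move: c2; size_lia.
  - by move=> x y; rewrite !mem_filter => /andP[_ xs] /andP[_ ys]; apply: fI.
  by rewrite !mem_filter => /andP[_ ?] /andP[_ ?] /andP[_ ?] *; exists x1, x2, x3.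
pose s' := sort (relpre f leq) (filter P s).
have ss' : sorted (relpre f leq) s' by apply: sort_sorted => x y; apply: leq_total.
have us' : uniq s' by rewrite sort_uniq filter_uniq.
have ms' x : x \in s' -> x \in s /\ phi x = N.
  by rewrite mem_sort mem_filter => /andP[/eqP].
have : 2 < size s' by rewrite size_sort size_filter.
case: s' ss' us' ms' => [|x1 [|x2 [|x3 s']]] //= /and3P[le12 le23 _] us' ms' _.
have [x1s p1] := ms' x1 (mem_head _ _).
have [x2s p2] : x2 \in s /\ phi x2 = N by apply: ms'; rewrite !inE eqxx orbT.
have [x3s p3] : x3 \in s /\ phi x3 = N by apply: ms'; rewrite !inE eqxx !orbT.
have lt x y : x \in s -> y \in s -> x != y -> f x <= f y -> f x < f y.
  move=> xs ys xy le; rewrite ltn_neqAle le andbT.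
  by apply: contra xy => /eqP /fI ->.
move: us'; rewrite !inE !negb_or => /andP[/and3P[n12 _ _] /andP[/andP[n23 _] _]].
by exists x1, x2, x3; split; rewrite ?p1 ?p2 ?p3 // lt.
Qed.

(** [i * N %/ c] is the class of i when c positions are cut into N nearly equal intervals. *)
Lemma class_gap c N i j : 0 < c -> i * N %/ c = j * N %/ c -> i <= j -> N * (j - i) <= c.
Proof.
move=> c0 eqd ij; have := ltn_ceil (j * N) c0; have := leq_divM (i * N) c.
by rewrite -eqd mulSn mulnBr; move: (i * N %/ c) => q; clear; nia.
Qed.

(** Since N is at most 8 b + 1, the quotient by [N.*2] is at least 1, so rounding it down costs at
    most a factor 2. *)
Lemma class_size a b N m : 0 < a <= b -> 0 < N -> N.-1 * N.-1 < 64 * a -> 288 * b <= m ->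
  (N * (m.-1 %/ N.*2)).*2 < m /\ m <= 4 * N * (m.-1 %/ N.*2).
Proof.
move=> /andP[a0 ab] N0 N1 bm.
have Nb : N <= 8 * b + 1.
  rewrite leqNgt; apply/negP=> lt.
  have : (8 * b + 1) * (8 * b + 1) <= N.-1 * N.-1 by apply: leq_mul; lia.
  have -> : (8 * b + 1) * (8 * b + 1) = 64 * (b * b) + 16 * b + 1 by clear; nia.
  have : b <= b * b by rewrite leq_pmulr //; lia.
  by move: N1 ab; move: (N.-1 * _) (b * b) => u v; clear; lia.
have N2 : 0 < N.*2 by rewrite double_gt0.
have := leq_divM m.-1 N.*2; have := ltn_ceil m.-1 N2; set q := _ %/ _.
have -> : q * N.*2 = (N * q).*2 by rewrite -!muln2 mulnA [q * N]mulnC.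
have -> : q.+1 * N.*2 = (N * q).*2 + N.*2 by rewrite mulSn addnC -!muln2 mulnA [q * N]mulnC.
rewrite -mulnA; case: q => [|q]; first by rewrite muln0; clear -Nb bm a0 ab; lia.
by rewrite mulnS; move: (N * q) => p; clear -Nb bm a0 ab; lia.
Qed.

Section Merge.
Variables (T : finType) (e : rel T) (F : {set {set T}}) (L0 theta : nat) (R : rcfType).
Hypothesis e_sym : symmetric e.
Hypothesis gF : good_family e F.
Local Notation tv := (tv F).
Local Notation k := (tv setT).
Local Notation tvs s := (tv [set x in s]).
Implicit Types (A B : seq T) (l : T * seq T).

Definition direct A B l := [/\ path e l.1 l.2, uniq (verts l), l.1 \in A, lend l \in B &
  {in verts l, forall z, (z \in A -> z = l.1) /\ (z \in B -> z = lend l)}].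

Lemma join_cycles A B l l' (mA mB : seq T) : {in A, forall z, z \notin B} ->
  direct A B l -> direct A B l' -> {in verts l, forall z, z \notin verts l'} ->
  path e l.1 (rcons mA l'.1) -> uniq mA -> {subset mA <= A} -> l.1 \notin mA -> l'.1 \notin mA ->
  path e (lend l') (rcons mB (lend l)) -> uniq mB -> {subset mB <= B} ->
  lend l \notin mB -> lend l' \notin mB ->
  simple_cycle e (rev (verts l) ++ mA ++ verts l' ++ mB).
Proof.
move=> dAB [pl ul lA lB tl] [pl' ul' lA' lB' tl'] dl pA umA mAA xA yA pB umB mBB xB yB.
have eR : rev (verts l) = lend l :: rev (belast l.1 l.2).
  by rewrite /verts lastI rev_rcons.
have szv u : size (verts u) = (size u.2).+1 by [].
have ll : 1 < size (verts l).
  have l20 : l.2 <> [::].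
    by move=> l20; have := dAB _ lA; move: lB; rewrite /lend l20 /= => ->.
  by rewrite szv; case: (l.2) l20.
apply/and3P; split.
- by move: ll; rewrite !size_cat size_rev !szv; size_lia.
- rewrite eR.
  rewrite -[cycle _ _]/(path e (lend l) (rcons (rev (belast l.1 l.2) ++ mA ++ verts l' ++ mB) (lend l))).
  have -> : rcons (rev (belast l.1 l.2) ++ mA ++ verts l' ++ mB) (lend l) =
    (rev (belast l.1 l.2) ++ mA ++ verts l') ++ rcons mB (lend l).
    by rewrite -!cats1 -!catA.
  by rewrite cat_path path_join //= !last_cat; exact: pB.
- rewrite cat_uniq rev_uniq; apply/and3P; split=> //; [apply/hasPn=> z | ].
    rewrite !mem_cat /= mem_rev => zM; apply/negP=> zl; have [hA' hB'] := tl z zl.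
    case/or3P: zM => [zm|zl'|zm]; last 1 first.
    + by move: xB; rewrite -(hB' (mBB z zm)) zm.
    + by move: xA; rewrite -(hA' (mAA z zm)) zm.
    + by have := dl z zl; rewrite zl'.
  rewrite cat_uniq umA; apply/and3P; split=> //; [apply/hasPn=> z | ].
    rewrite mem_cat /= => zM; apply/negP=> zA.
    case/orP: zM => [zl'|zm]; last by have := dAB z (mAA z zA); rewrite (mBB z zm).
    by have [h _] := tl' z zl'; move: yA; rewrite -(h (mAA z zA)) zA.
  rewrite cat_uniq ul' umB andbT; apply/hasPn=> z zm /=; apply/negP=> zl'.
  by have [_ h] := tl' z zl'; move: yB; rewrite -(h (mBB z zm)) zm.
Qed.

Lemma disjoint_ends l l' : {in verts l, forall z, z \notin verts l'} -> l.1 != l'.1 /\ lend l' != lend l.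
Proof.
move=> dl; split.
  by apply: contraNneq (dl _ (fst_verts l)) => ->; apply: fst_verts.
by apply: contraNneq (dl _ (lend_verts l)) => <-; apply: lend_verts.
Qed.

(** Positions are compared along the sequence, not around the cycle: a merge gives up the arc that
    does not wrap around. *)
Definition gap A x y := maxn (index x A) (index y A) - minn (index x A) (index y A).

Definition between A x y z := minn (index x A) (index y A) < index z A < maxn (index x A) (index y A).

(** M follows the two links and, on each of A and B, the arc that wraps around. What is lost lies
    strictly between the two attachments; the last clause lets two merges on disjoint intervals
    cover A. *)
Lemma merge_cycles A B l l' : simple_cycle e A -> simple_cycle e B ->
  {in A, forall z, z \notin B} -> direct A B l -> direct A B l' ->
  {in verts l, forall z, z \notin verts l'} ->
  exists M, [/\ simple_cycle e M,
    size A + size B <= size M + gap A l.1 l'.1 + gap B (lend l) (lend l'),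
    {subset M <= A ++ B ++ verts l ++ verts l'} &
    {in A, forall z, ~~ between A l.1 l'.1 z -> z \in M}].
Proof.
move=> /and3P[szA cA uA] /and3P[szB cB uB] dAB dl1 dl2 dl.
have [n1 n2] := disjoint_ends dl.
have [[_ _ lA lB _] [_ _ lA' lB' _]] := (dl1, dl2).
have [_ [mA [pA umA] [hA sA]]] := arcs e_sym uA cA lA lA' n1.
have [_ [mB [pB umB] [hB sB]]] := arcs e_sym uB cB lB' lB n2.
have out i j h : h = i \/ h = j -> (h < minn i j) || (maxn i j < h) = false by clear; lia.
have [xA yA] : l.1 \notin mA /\ l'.1 \notin mA by rewrite !hA !out ?andbF; auto.
have [xB yB] : lend l \notin mB /\ lend l' \notin mB by rewrite !hB !out ?andbF; auto.
have mAA z : z \in mA -> z \in A by rewrite hA => /andP[].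
have mBB z : z \in mB -> z \in B by rewrite hB => /andP[].
have szv u : size (verts u) = (size u.2).+1 by [].
exists (rev (verts l) ++ mA ++ verts l' ++ mB); split.
- by apply: (@join_cycles A B).
- rewrite !size_cat size_rev /gap !szv; move: sA sB.
  rewrite [minn (index (lend l') B) _]minnC [maxn (index (lend l') B) _]maxnC.
  move: (maxn _ _ - _) (maxn _ _ - _); size_lia.
- move=> z; rewrite !mem_cat mem_rev => /or4P[->|/mAA->|->|/mBB->]; by rewrite ?orbT.
- move=> z zA nb; rewrite !mem_cat mem_rev hA zA /=.
  have [->|zx] := eqVneq z l.1; first by rewrite fst_verts.
  have [->|zy] := eqVneq z l'.1; first by rewrite fst_verts !orbT.
  suff -> : (index z A < minn (index l.1 A) (index l'.1 A)) ||
      (maxn (index l.1 A) (index l'.1 A) < index z A) by rewrite orbT.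
  have [e1 e2] : index z A <> index l.1 A /\ index z A <> index l'.1 A.
    split=> ei; first by case/eqP: zx; rewrite -(nth_index z lA) -ei nth_index.
    by case/eqP: zy; rewrite -(nth_index z lA') -ei nth_index.
  move: nb e1 e2; rewrite /between; clear; lia.
Qed.

Definition good_ring (c : seq T * nat) :=
  [/\ 0 < c.2, simple_cycle e c.1, theta <= tvs c.1 &
    (weight R L0 c.2 <= 2 * (size c.1)%:R)%R].

Hypothesis theta_small : theta.*2 <= k.
Hypothesis dich : forall c, simple_cycle e c -> theta <= tvs c -> tvs c = k.

Lemma cover_count (rest : seq (seq T * nat)) (ls : seq (T * seq T)) :
  {in ls, forall l, lend l \in vfam rest} ->
  size ls <= \sum_(c <- rest) count (fun l => lend l \in c.1) ls.
Proof.
elim: ls => // l ls IHls h; rewrite /= big_split /= -[(size ls).+1]add1n.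
apply: leq_add; last by apply: IHls => u uls; apply: h; rewrite inE uls orbT.
have /mem_vfam[c cr lc] := h l (mem_head _ _).
by rewrite (big_rem c) //= lc.
Qed.

(** Averaging: every link ends on some ring, so not all rings can receive less than their share c.2
    / t. *)
Lemma popular_ring t (rest : seq (seq T * nat)) (ls : seq (T * seq T)) :
  {in ls, forall l, lend l \in vfam rest} -> 0 < size rest ->
  \sum_(c <- rest) c.2 <= t ->
  exists2 c, c \in rest & size ls * c.2 <= t * count (fun l => lend l \in c.1) ls.
Proof.
move=> lsr r0 st; apply: contrapT => nex.
have : \sum_(c <- rest) (t * count (fun l => lend l \in c.1) ls + 1) <= \sum_(c <- rest) (size ls * c.2).
  rewrite big_seq [X in _ <= X]big_seq; apply: leq_sum => c cr; rewrite addn1 ltnNge.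
  by apply/negP=> le; apply: nex; exists c.
rewrite big_split /= -!big_distrr /= sum1_size.
have := cover_count lsr; move: (\sum_(c <- rest) count _ _) (\sum_(c <- rest) c.2) st => s1 s2.
move: (size rest) (size ls) r0 => r n; clear => r0 s2t ns1 le.
have : n * s2 <= s1 * t by apply: leq_mul.
by rewrite [s1 * t]mulnC; move: le r0; move: (n * s2) (t * s1); clear; lia.
Qed.

(* The ring a of least count sends k disjoint paths to the other rings, and some ring b
   receives at least 288 times its count.  Three of those paths have nearby ends both on
   a and on b.  The merges along the first and second and along the second and third
   miss disjoint parts of a, so one of them has tv at least k/2. *)
Lemma merge_rings t (fam : seq (seq T * nat)) : 0 < t -> 288 * t <= k ->
  uniq (vfam fam) -> {in fam, forall c, good_ring c} -> \sum_(c <- fam) c.2 = t ->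
  1 < size fam -> exists fam', [/\ uniq (vfam fam'), {in fam', forall c, good_ring c},
    \sum_(c <- fam') c.2 = t & size fam' < size fam].
Proof.
move=> t0 tk ufam gfam sfam szfam.
have [|a afam amin] := @ex_minimal _ (fun c => c \in fam) snd.
  by case: fam szfam {ufam gfam sfam} => // c fam _; exists c; rewrite mem_head.
have pa := perm_to_rem afam; set rest := rem a fam in pa.
have szr : size rest = (size fam).-1 by rewrite size_rem.
have sr : a.2 + \sum_(c <- rest) c.2 = t by rewrite -sfam (perm_big _ pa) big_cons.
have rfam c : c \in rest -> c \in fam by move/mem_rem.
have := ufam; rewrite (perm_uniq (perm_vfam pa)) -[vfam _]/(a.1 ++ vfam rest) cat_uniq.
move=> /and3P[ua /hasPn dar ur].
pose U := [set x in vfam rest].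
have tA : tvs a.1 = k by have [_ sc th _] := gfam a afam; apply: dich.
have tU : tv U = k.
  have [c cr] : exists c, c \in rest.
    have : 0 < size rest by rewrite szr; move: szfam; size_lia.
    by case: (rest) => // c r _; exists c; rewrite mem_head.
  have [_ sc th _] := gfam c (rfam c cr); apply/eqP.
  rewrite eqn_leq tv_le -(dich sc th) /=; apply/tvS/subsetP=> z; rewrite !inE => zc.
  by apply/mem_vfam; exists c.
have [||ls [szl dl al tl _]] := @linkage _ _ _ gF k [set x in a.1] U set0.
- by rewrite tv0 addn0 tA.
- by rewrite tv0 addn0 tU.
have lU : {in ls, forall l, lend l \in vfam rest}.
  by move=> l /(allP al)/and4P[_ + _ _]; rewrite inE.
have [||b br] := popular_ring lU _ (_ : _ <= t).
- by rewrite szr; move: szfam; size_lia.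
- by rewrite -sr leq_addl.
rewrite szl -size_filter; set lsb := filter _ ls => cnt.
have pb := perm_to_rem br; set rest' := rem b rest in pb.
have := ur; rewrite (perm_uniq (perm_vfam pb)) -[vfam _]/(b.1 ++ vfam rest') cat_uniq.
move=> /and3P[ub /hasPn dbr ur'].
have inr z : z \in b.1 \/ z \in vfam rest' -> z \in vfam rest.
  by rewrite (perm_mem (perm_vfam pb)) /vfam /= mem_cat => -[->|->]; rewrite ?orbT.
have [a0 sca tha wa] := gfam a afam; have [b0 scb thb wb] := gfam b (rfam b br).
have ab := amin b (rfam b br).
have m288 : 288 * b.2 <= size lsb.
  by move: cnt tk t0; move: (size lsb) k; clear; nia.
(* NA is 8 sqrt a.2 rounded up. *)
have [|NA NAa NAmin] := @ex_minnP (fun N => 64 * a.2 <= N * N).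
  by exists (64 * a.2); rewrite leq_pmulr // muln_gt0.
have NA0 : 0 < NA.
  have : 0 < NA * NA by apply: leq_trans NAa; rewrite muln_gt0.
  by rewrite muln_gt0 => /andP[].
have NAlt : NA.-1 * NA.-1 < 64 * a.2.
  by rewrite ltnNge; apply/negP=> /NAmin; move: NA0; clear; lia.
pose NB := (size lsb).-1 %/ NA.*2.
have [NBlt NBge] : (NA * NB).*2 < size lsb /\ size lsb <= 4 * NA * NB.
  by apply: (@class_size a.2 b.2) => //; rewrite a0.
have dab : {in a.1, forall z, z \notin b.1}.
  by move=> z za; apply/negP=> zb; case/negP: (dar z (inr z (or_introl zb))).
have dirP l : l \in lsb -> direct a.1 b.1 l /\ l \in ls.
  rewrite mem_filter => /andP[lb lls]; split=> //.
  have /and4P[lA lU' pl ul] := allP al l lls; have [tA' tU'] := tl l lls.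
  split=> //; first by move: lA; rewrite inE.
  move=> z zl; split=> zX; first by apply: tA'; rewrite ?inE.
  by apply: tU' => //; rewrite inE; apply: inr; left.
have dis l l' : l \in lsb -> l' \in lsb -> l <> l' -> {in verts l, forall z, z \notin verts l'}.
  move=> /dirP[_ lls] /dirP[_ lls'] nl z zl; apply/negP=> zl'; apply: nl.
  exact: disj_inj dl lls lls' zl zl'.
have ca0 : 0 < size a.1 by case/and3P: sca => h _ _; apply: leq_trans h.
have cb0 : 0 < size b.1 by case/and3P: scb => h _ _; apply: leq_trans h.
have idxA l : l \in lsb -> index l.1 a.1 < size a.1.
  by case/dirP=> [[_ _ h _ _] _]; rewrite index_mem.
have idxB l : l \in lsb -> index (lend l) b.1 < size b.1.
  by case/dirP=> [[_ _ _ h _] _]; rewrite index_mem.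
have divlt i N c : 0 < c -> 0 < N -> i < c -> i * N %/ c < N.
  by move=> c0 N0 ic; rewrite ltn_divLR // mulnC ltn_pmul2l.
have NB0 : 0 < NB.
  have : 0 < 4 * NA * NB by apply: leq_trans NBge; apply: leq_trans m288; rewrite muln_gt0.
  by rewrite muln_gt0 => /andP[].
(* [phi] numbers the pairs of a class on a and a class on b. There are NA * NB pairs and more than
   twice as many links. *)
pose phi l := index l.1 a.1 * NA %/ size a.1 + NA * (index (lend l) b.1 * NB %/ size b.1).
have [||||l1 [l2 [l3 [[l1s l2s l3s] p12 p23 i12 i23]]]] :=
    @pigeon3 _ lsb phi (fun l => index l.1 a.1) (NA * NB).
- by rewrite filter_uniq // disj_uniq.
- move=> l lls; have h1 := divlt _ _ _ ca0 NA0 (idxA l lls).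
  have h2 := divlt _ _ _ cb0 NB0 (idxB l lls).
  apply: leq_trans (_ : NA + NA * (index (lend l) b.1 * NB %/ size b.1) <= _).
    by rewrite ltn_add2r.
  by rewrite -mulnS leq_mul2l h2 orbT.
- exact: NBlt.
- move=> l l' lls lls' eqi; have [[_ _ h _ _] hl] := dirP l lls; have [[_ _ h' _ _] hl'] := dirP l' lls'.
  apply: (disj_inj dl hl hl' (fst_verts l)).
  by rewrite -(nth_index l.1 h) eqi nth_index // fst_verts.
have merge l l' : l \in lsb -> l' \in lsb -> index l.1 a.1 < index l'.1 a.1 -> phi l = phi l' ->
  exists M, [/\ simple_cycle e M, (weight R L0 (a.2 + b.2) <= 2 * (size M)%:R)%R,
    {subset M <= a.1 ++ b.1 ++ verts l ++ verts l'} &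
    {in a.1, forall z, ~~ (index l.1 a.1 < index z a.1 < index l'.1 a.1) -> z \in M}].
  move=> lls lls' ilt eqp; have [dl1 _] := dirP l lls; have [dl2 _] := dirP l' lls'.
  have nl : l <> l' by move=> ell; rewrite ell ltnn in ilt.
  have [M [sM szM subM inM]] := merge_cycles sca scb dab dl1 dl2 (dis l l' lls lls' nl).
  have h1 := divlt _ _ _ ca0 NA0 (idxA l lls).
  have h1' := divlt _ _ _ ca0 NA0 (idxA l' lls').
  have eqA : index l.1 a.1 * NA %/ size a.1 = index l'.1 a.1 * NA %/ size a.1.
    have := congr1 (fun x => x %% NA) eqp.
    by rewrite /phi ![NA * _]mulnC ![_ + _ * NA]addnC !modnMDl !modn_small.
  have eqB : index (lend l) b.1 * NB %/ size b.1 = index (lend l') b.1 * NB %/ size b.1.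
    move: eqp; rewrite /phi eqA => /addnI/eqP.
    by rewrite eqn_pmul2l // => /eqP.
  have gapA : gap a.1 l.1 l'.1 = index l'.1 a.1 - index l.1 a.1.
    by rewrite /gap (maxn_idPr (ltnW ilt)) (minn_idPl (ltnW ilt)).
  exists M; split=> //; last first.
    move=> z za nb; apply: inM => //.
    by rewrite /between (maxn_idPr (ltnW ilt)) (minn_idPl (ltnW ilt)).
  apply: (@merge_bound R L0 a.2 b.2 NA NB (size lsb) (size a.1) (size b.1)
     (gap a.1 l.1 l'.1) (gap b.1 (lend l) (lend l')) (size M)) => //.
  - by rewrite a0.
  - by rewrite gapA; apply: class_gap (ltnW ilt).
  - rewrite /gap; have [le|/ltnW le] := leqP (index (lend l) b.1) (index (lend l') b.1).
      exact: class_gap.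
    by apply: class_gap => //; rewrite eqB.
have k0 : theta <= k by apply: leq_trans theta_small; rewrite -addnn leq_addr.
have [M [l [l' [[lls lls'] sM wM subM thM]]]] : exists M l l', [/\ l \in lsb /\ l' \in lsb,
    simple_cycle e M, (weight R L0 (a.2 + b.2) <= 2 * (size M)%:R)%R,
    {subset M <= a.1 ++ b.1 ++ verts l ++ verts l'} & theta <= tvs M].
  have [M1 [sM1 w1 sub1 in1]] := merge l1 l2 l1s l2s i12 p12.
  have [M2 [sM2 w2 sub2 in2]] := merge l2 l3 l2s l3s i23 p23.
  have : k <= tvs M1 + tvs M2.
    rewrite -tA; apply: tv_cover; apply/subsetP=> z; rewrite !inE => za.
    have [h|h] := boolP (index l1.1 a.1 < index z a.1 < index l2.1 a.1); last by rewrite in1.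
    rewrite in2 ?orbT //; move: h i12 i23.
    by move: (index l1.1 _) (index l2.1 _) (index l3.1 _) (index z _); clear; lia.
  move=> ksum; have [t1|t1] := leqP theta (tvs M1); first by exists M1, l1, l2.
  exists M2, l2, l3; split=> //; move: ksum t1 theta_small.
  by move: (tvs M1) (tvs M2) k; clear; lia.
exists ((M, a.2 + b.2) :: rest'); split.
- rewrite -[vfam _]/(M ++ vfam rest') cat_uniq ur'; case/and3P: (sM) => _ _ ->.
  rewrite andbT /=; apply/hasPn=> z zr /=; apply/negP=> /subM.
  have zU := inr z (or_intror zr).
  (* A link meets the union of the other rings only in its end, and that end lies on b. *)
  have nv u : u \in lsb -> z \notin verts u.
    move=> uls; apply/negP=> zu; have [_ uls'] := dirP u uls.
    have [_ tU'] := tl u uls'; have ez : z = lend u by apply: tU' => //; rewrite inE.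
    have [[_ _ _ zb _] _] := dirP u uls; rewrite -ez in zb.
    by have := dbr z zr; rewrite /= zb.
  rewrite !mem_cat (negPf (nv l lls)) (negPf (nv l' lls')) !orbF => /orP[za|zb].
    by have := dar z zU; rewrite /= za.
  by have := dbr z zr; rewrite /= zb.
- move=> c; rewrite inE => /predU1P[->|cr]; last by apply/gfam/rfam; apply: mem_rem cr.
  by split=> //=; rewrite addn_gt0 a0.
- by rewrite -sr big_cons (perm_big _ pb) big_cons /= addnA.
- by rewrite /= size_rem // szr; move: szfam; size_lia.
Qed.

End Merge.

(** * The bound in terms of the length *)

Section WeightLemmas.
Import Order.TTheory GRing.Theory Num.Theory.
Variable R : rcfType.

Lemma weight_ge L n : ((L * n)%:R <= weight R L n)%R.
Proof. by rewrite /weight natrM ler_wpM2l // lerDl sqrtr_ge0. Qed.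

(** This makes the initial heavy cycles good rings; it rests on sqrt n <= n for natural n. *)
Lemma weight_le L n : (weight R L n <= 2 * (L * n)%:R)%R.
Proof.
have h : (Num.sqrt n%:R <= n%:R :> R)%R.
  case: n => [|n]; first by rewrite sqrtr0.
  rewrite -[leRHS](sqr_sqrtr (ler0n R n.+1)) expr2 ler_peMr ?sqrtr_ge0 //.
  by rewrite -[leLHS]sqrtr1 ler_wsqrtr // ler1n.
rewrite /weight natrM mulrCA ler_wpM2l //; lra.
Qed.

End WeightLemmas.

Section Part2.
Import Order.TTheory GRing.Theory Num.Theory.
Variables (T : finType) (e : rel T) (F : {set {set T}}) (R : rcfType).
Hypothesis e_sym : symmetric e.
Hypothesis gF : good_family e F.
Local Notation tv := (tv F).
Local Notation k := (tv setT).
Local Notation tvs s := (tv [set x in s]).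

Lemma tvs_cat (s1 s2 : seq T) : tvs (s1 ++ s2) <= tvs s1 + tvs s2.
Proof. by apply: tv_cover; apply/subsetP=> z; rewrite !inE mem_cat. Qed.

Lemma take_of_weight (s : seq T) v : v <= tvs s -> exists p, tvs (take p s) = v.
Proof.
move=> vs; have [||p _ tp] := @discrete_ivt (fun i => tvs (take i s)) (size s) v (tv_take_step F s).
- by rewrite take0 (_ : [set x in [::]] = set0) ?tv0 //; apply/setP=> z; rewrite !inE.
- by rewrite take_size.
by exists p.
Qed.

Lemma transversal_cycle l theta c : (forall Q, Q \in F -> #|Q| <= l.+1) ->
  l.*2 < theta.-1 * (theta + 4) -> simple_cycle e c -> theta <= tvs c -> tvs c = k.
Proof.
move=> Fl lt /and3P[sz3 cc uc] th; apply: tv_setT => Q QF; apply: contrapT => /negP nm.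
have ncQ : {in c, forall z, z \notin Q}.
  by move=> z zc; apply: contra nm => zQ; apply/touchesP; exists z; rewrite ?inE.
have := sun_bound e_sym gF sz3 uc cc QF ncQ; rewrite leqNgt => /negP[].
apply: leq_ltn_trans (_ : l.*2 < _).
  by rewrite leq_double; case: #|Q| (Fl Q QF).
apply: leq_trans lt _; apply: leq_mul; first by move: th; move: (tv _); clear; lia.
by rewrite leq_add2r (leq_trans th) // tvs_size.
Qed.

Lemma collapse_rings L0 theta t (fam : seq (seq T * nat)) : 0 < t -> 288 * t <= k ->
  theta.*2 <= k -> (forall c, simple_cycle e c -> theta <= tvs c -> tvs c = k) ->
  uniq (vfam fam) -> {in fam, forall c, good_ring e F L0 theta R c} ->
  \sum_(c <- fam) c.2 = t -> exists2 c, simple_cycle e c & L0 * t <= (size c).*2.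
Proof.
move=> t0 tk thk dich.
have [n] := ubnP (size fam); elim: n => // n IHn in fam * => szn uf gf sf.
have [lt|le] := ltnP 1 (size fam).
  have [fam' [uf' gf' sf' szf]] := merge_rings e_sym gF thk dich t0 tk uf gf sf lt.
  by apply: (IHn fam') => //; apply: leq_trans szf _.
case: fam uf gf sf le {szn} => [|c [|c' fam]] // uf gf sf _.
  by rewrite big_nil in sf; rewrite -sf in t0.
have [_ sc _ w] := gf c (mem_head _ _); exists c.1 => //.
rewrite big_seq1 in sf; rewrite -(ler_nat R) -mul2n -sf.
by apply: le_trans (weight_ge _ _ _) _; rewrite natrM.
Qed.

(** The link avoids Z, so together with the stretch of the line between its ends it forms a cycle
    running through all of Z. *)
Lemma close_link (X Z Y : seq T) (l : T * seq T) : 0 < size Z ->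
  sorted e (X ++ Z ++ Y) -> uniq (X ++ Z ++ Y) ->
  link e [set x in X] [set x in Y] l -> tight [set x in X] [set x in Y] l ->
  {in verts l, forall z, z \notin [set x in Z]} ->
  (exists x m y, [/\ l = (x, rcons m y), x \in X, y \in Y &
     {in m, forall z, z \notin X ++ Z ++ Y}]) /\
  exists c, [/\ simple_cycle e c, {subset Z <= c} & {subset c <= verts l ++ X ++ Z ++ Y}].
Proof.
move=> Z0 sL uL /and4P[lX lY pl ul] [tX tY] tZ.
rewrite !inE in lX lY; case: l => x p in lX lY pl ul tX tY tZ *.
have dXY z : z \in X -> z \notin Y.
  move=> zX; apply/negP=> zY; move: uL; rewrite cat_uniq => /and3P[_ /hasPn/(_ z) + _].
  by rewrite mem_cat zY orbT => /(_ isT); rewrite /= zX.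
case/lastP: p => [|m y] in lX lY pl ul tX tY tZ *; first by case/negP: (dXY _ lX).
rewrite /lend /= last_rcons in lX lY pl tX tY.
have [xm xy um ym] : [/\ x \notin m, x != y, uniq m & y \notin m].
  by move: ul; rewrite /verts /= mem_rcons inE negb_or rcons_uniq => /and3P[/andP[-> ->] -> ->].
have mV z : z \in m -> z \in verts (x, rcons m y).
  by move=> zm; rewrite /verts /= inE mem_rcons inE zm !orbT.
have mL z : z \in m -> z \notin X ++ Z ++ Y.
  move=> zm; rewrite !mem_cat !negb_or; apply/and3P; split.
  - by apply/negP=> zX; move: xm; rewrite -(tX z (mV z zm)) ?inE // zm.
  - by have := tZ z (mV z zm); rewrite inE.
  - by apply/negP=> zY; move: ym; rewrite -(tY z (mV z zm)) ?inE // zm.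
split; first by exists x, m, y.
case/path.splitPr: lX {dXY tX} sL uL mL => X1 X2 sL uL mL.
case/path.splitPr: lY {tY} sL uL mL => Y1 Y2.
set b := X2 ++ Z ++ Y1.
have -> : (X1 ++ x :: X2) ++ Z ++ Y1 ++ y :: Y2 = X1 ++ x :: b ++ y :: Y2.
  by rewrite /b -catA /= -!catA.
move=> sL uL mL.
have bZ z : z \in Z -> z \in b by rewrite !mem_cat => ->; rewrite orbT.
have b0 : 0 < size b by rewrite /b !size_cat; move: Z0; size_lia.
clearbody b.
have pb : path e x (rcons b y).
  by have [_] := cat_sorted2 sL; rewrite /= -cat_rcons cat_path => /andP[].
have [xb yb ub] : [/\ x \notin b, y \notin b & uniq b].
  move: uL; rewrite cat_uniq cons_uniq mem_cat negb_or => /and3P[_ _ /andP[/andP[-> _]]].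
  by rewrite cat_uniq => /and3P[-> /norP[->]].
exists (x :: m ++ y :: rev b); split.
- apply: simple_cycle_join => //.
    by move=> z /mL; rewrite !(mem_cat, inE) !negb_or; case/andP=> _ /and3P[_ -> _].
  by move: b0; size_lia.
- by move=> z /bZ zb; rewrite inE mem_cat inE mem_rev zb !orbT.
- move=> z; rewrite !(mem_cat, inE, mem_rcons) mem_rev.
  by case/or4P=> ->; rewrite ?orbT.
Qed.

(** The cycle closed up along the line contains Z, hence has full weight k. The line accounts for
    only the weights of X, Z and Y, so the link weighs, and thus has, at least L0. *)
Lemma row_chain theta L0 X Z Y (l : T * seq T) : 0 < theta -> theta <= L0 -> theta <= tvs Z ->
  L0 + tvs X + tvs Z + tvs Y <= k ->
  (forall c, simple_cycle e c -> theta <= tvs c -> tvs c = k) ->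
  sorted e (X ++ Z ++ Y) -> uniq (X ++ Z ++ Y) ->
  link e [set x in X] [set x in Y] l -> tight [set x in X] [set x in Y] l ->
  {in verts l, forall z, z \notin [set x in Z]} ->
  chain e F L0 theta (X ++ Z ++ Y) (verts l, 1).
Proof.
move=> th0 thL thZ Lk dich sL uL ll lt lZ.
have Z0 : 0 < size Z by apply: leq_trans th0 (leq_trans thZ (tvs_size F Z)).
have [[x [m [y [el xX yY mL]]]] [c [sc Zc cs]]] := close_link Z0 sL uL ll lt lZ.
have big : L0 <= tvs (verts l).
  have tc : tvs c = k by apply: dich => //; apply: leq_trans thZ _; apply: tvs_sub.
  have := tvs_sub F cs.
  have := tvs_cat (verts l) (X ++ Z ++ Y); have := tvs_cat X (Z ++ Y); have := tvs_cat Z Y.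
  rewrite tc; move: Lk; move: (tvs (verts l ++ _)) (tvs (verts l)) (tvs (X ++ _)) (tvs (Z ++ _)).
  by move: (tvs X) (tvs Z) (tvs Y) k; clear; lia.
have /and4P[_ _ pl _] := ll.
split=> //=.
- by apply/and3P; split=> //=; rewrite ?muln1 ?(leq_trans big) ?tvs_size //; apply: leq_trans big.
- exists x, m, y; split; rewrite ?el ?mem_cat ?xX ?yY ?orbT //.
Qed.

(** From 1089 (k' - 1) < k'^2 follows k' >= 1088, hence t >= 3 and q >= 54. Then the per-row count
    is at least 0.84 k' and k' < 384 t, so the last product exceeds 0.84 k'^2 / 384 > 2.38 l. *)
Lemma threshold_arith l k' q t : 0 < l -> k' <= l.+1 -> 1089 * l < k' * k' ->
  20 * q <= k' -> k' < 20 * q.+1 -> 288 * t <= k' -> k' < 288 * t.+1 ->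
  [/\ 3 <= t, 54 <= q, l.*2 < q * (q.+1 + 4) & l.+1.*2 < (k' - 2 * t - 3 * q.+1) * t].
Proof.
move=> l0 kl lk q1 q2 t1 t2.
have k1088 : 1088 <= k'.
  rewrite leqNgt; apply/negP=> lt.
  have [le1|gt1] := leqP k' 1.
    by move: lk l0 le1; clear; case: k' => [|[|k']] //; lia.
  have : (k' - 1) * (1088 - k') >= 1 by rewrite muln_gt0; move: lt gt1; clear; lia.
  move: lk kl lt gt1; clear; nia.
have [t3 q54] : 3 <= t /\ 54 <= q by move: k1088 q2 t2; clear; lia.
split=> //.
  have : k' * k' <= (20 * q + 19) * (20 * q + 19) by apply: leq_mul; move: q2; clear; lia.
  by move: lk q54; clear; nia.
have kt : k' < 384 * t by move: t2 t3; clear; lia.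
have Lk : 84 * k' <= 100 * (k' - 2 * t - 3 * q.+1) by move: k1088 q1 t1; clear; lia.
have : 84 * k' * k' <= 100 * (k' - 2 * t - 3 * q.+1) * (384 * t) by apply: leq_mul => //; exact: ltnW.
move: (_ - _ - _) => L; move: lk k1088; clear; nia.
Qed.

Theorem tv_square_le_length (s : seq T) l : 0 < l -> uniq s -> sorted e s ->
  [set x in s] \in F -> size s <= l.+1 -> (forall Q, Q \in F -> #|Q| <= l.+1) ->
  (forall c, simple_cycle e c -> size c <= l.+1) -> k * k <= 1089 * l.
Proof.
move=> l0 us ss sF szs Fl cl; rewrite leqNgt; apply/negP=> lk.
have ts : tvs s = k := tv_mem gF sF.
have kl : k <= l.+1 by rewrite -ts (leq_trans (tvs_size _ _)).
(* Cycles count as heavy from weight [q.+1] on, t is the number of rows, and L0 is k minus the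
   weights of the pieces X, Z and Y chosen below. *)
pose q := k %/ 20; pose t := k %/ 288; pose L0 := k - 2 * t - 3 * q.+1.
have [q1 q2] : 20 * q <= k /\ k < 20 * q.+1.
  by rewrite mulnC leq_divM mulnC ltn_ceil.
have [t1 t2] : 288 * t <= k /\ k < 288 * t.+1.
  by rewrite mulnC leq_divM mulnC ltn_ceil.
have [t3 q54 lq Lt] := threshold_arith l0 kl lk q1 q2 t1 t2.
have dich c : simple_cycle e c -> q.+1 <= tvs c -> tvs c = k.
  by apply: (@transversal_cycle l).
(* The extra [q.+1] in the weights of X and Y makes up for Z, which the t links have to avoid. *)
have [p tX] : exists p, tvs (take p s) = t + q.+1.
  by apply: take_of_weight; rewrite ts; move: t1 q1 t3 q54; clear; lia.
set X := take p s in tX; pose s1 := drop p s.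
have t_s1 : k <= t + q.+1 + tvs s1.
  by rewrite -tX; apply: leq_trans (tvs_cat _ _); rewrite cat_take_drop ts.
have [p' tZ] : exists p, tvs (take p s1) = q.+1.
  by apply: take_of_weight; move: t_s1 t1 q1 t3 q54; clear; lia.
set Z := take p' s1 in tZ; pose s2 := drop p' s1.
have t_s2 : k <= t + q.+1 + q.+1 + tvs s2.
  apply: leq_trans t_s1 _; rewrite -[t + q.+1 + q.+1 + _]addnA leq_add2l -tZ.
  by apply: leq_trans (tvs_cat _ _); rewrite cat_take_drop.
have [p2 tY] : exists p, tvs (take p s2) = t + q.+1.
  by apply: take_of_weight; move: t_s2 t1 q1 t3 q54; clear; lia.
set Y := take p2 s2 in tY.
have es : s = (X ++ Z ++ Y) ++ drop p2 s2 by rewrite -!catA !cat_take_drop.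
have uL : uniq (X ++ Z ++ Y) by move: us; rewrite es cat_uniq => /and3P[].
have sL : sorted e (X ++ Z ++ Y) by move: ss; rewrite es => /cat_sorted2[].
have [||ls [szl dl al tl nZ]] := @linkage _ _ _ gF t [set x in X] [set x in Y] [set x in Z].
- by rewrite tX tZ.
- by rewrite tY tZ.
have rowP l' : l' \in ls -> chain e F L0 q.+1 (X ++ Z ++ Y) (verts l', 1).
  move=> ll; apply: row_chain => //; [| by rewrite tZ | | exact: (allP al) | exact: tl | exact: nZ].
    by rewrite /L0; move: t1 q1 t3 q54; clear; lia.
  by rewrite tX tY tZ /L0; move: t1 q1 t3 q54; clear; lia.
pose cs := [seq (verts l', 1) | l' <- ls].
have [||fam [uf hf sf _]] := @close_chains _ e F L0 q.+1 e_sym _ _ cs uL sL.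
- by move: q54; clear; lia.
- split; last by move=> _ /mapP[l' ll ->]; apply: rowP.
  by rewrite /vfam -map_comp (eq_map (g := @verts T)).
have scs : \sum_(c <- cs) c.2 = t by rewrite big_map /= sum1_size.
have [|||||||c sc szc] := @collapse_rings L0 q.+1 t fam.
- by apply: leq_trans t3.
- by [].
- by move: q1 q54; clear; lia.
- exact: dich.
- by [].
- move=> c cf; have [/and3P[c0 szc tc] sc] := hf c cf; split=> //.
  by apply: le_trans (weight_le _ _ _) _; rewrite ler_wpM2l // ler_nat.
- by rewrite sf.
(* The single remaining cycle would have more than [l.+1] vertices. *)
by have := leq_trans Lt szc; rewrite ltn_double ltnNge (cl c sc).
Qed.

End Part2.

(** * Longest paths and longest cycles *)

Section Walks.
Variables (T : finType) (e : rel T).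
Hypothesis e_sym : symmetric e.
Implicit Types (s : seq T) (x y : T).

Lemma path_to s a x : path e a s -> x \in a :: s ->
  exists p, [/\ path e a p, last a p = x & {subset a :: p <= a :: s}].
Proof.
move=> + xs; case/path.splitPl: xs => p1 p2 lx; rewrite cat_path => /andP[pp1 _].
exists p1; split=> // z; rewrite !inE mem_cat => /orP[->//|->]; by rewrite orbT.
Qed.

Lemma sorted_conn s x y : sorted e s -> x \in s -> y \in s ->
  exists p, [/\ path e x p, last x p = y & {subset x :: p <= s}].
Proof.
case: s => // a s ps xs ys.
have [p [pp lp sp]] := path_to ps xs; have [q [pq lq sq]] := path_to ps ys.
have lr : last (last a p) (rev (belast a p)) = a.
  by case: (p) => //= b p'; rewrite rev_cons last_rcons.
exists (rev (belast a p) ++ q); rewrite -lp; split.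
- by rewrite cat_path (path_rev e_sym pp) lr.
- by rewrite last_cat lr.
- move=> z; rewrite inE mem_cat mem_rev => /or3P[/eqP->|/mem_belast/sp//|zq].
    by rewrite sp // mem_last.
  by rewrite sq // inE zq orbT.
Qed.

Lemma half_path s x : sorted e s -> uniq s -> x \in s ->
  exists h, [/\ path e x h, uniq (x :: h), {subset x :: h <= s} & size s <= (size h).*2.+1].
Proof.
move=> ss us xs; case/path.splitPr: xs ss us => p1 p2 ss us.
have [le|lt] := leqP (size p1) (size p2).
  exists p2; split.
  - by have [_] := cat_sorted2 ss.
  - by move: us; rewrite cat_uniq => /and3P[].
  - by move=> z; rewrite mem_cat orbC => ->.
  - by rewrite size_cat /=; move: le; size_lia.
move: ss us; rewrite -cat_rcons => ss us.
exists (rev p1); split.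
- by have [s1 _] := cat_sorted2 ss; have := sorted_rev e_sym s1; rewrite rev_rcons.
- by move: us; rewrite cat_uniq -rev_uniq rev_rcons => /and3P[].
- by move=> z; rewrite mem_cat -[z \in rcons _ _]mem_rev rev_rcons => ->.
- by rewrite size_cat size_rcons size_rev; move: lt; size_lia.
Qed.

Lemma splice a b b' c x y : sorted e (a ++ x :: b ++ y :: c) -> path e x (rcons b' y) ->
  sorted e (a ++ x :: b' ++ y :: c).
Proof.
move=> ss pb'; move: ss; rewrite -!cat_rcons.
case: a => [|a0 a] /=.
  by rewrite !cat_path pb' !last_rcons => /andP[].
by rewrite !cat_path !last_rcons pb' => /and3P[-> _ ->].
Qed.

Lemma splice_cycle a b b' c x y : cycle e (a ++ x :: b ++ y :: c) -> path e x (rcons b' y) ->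
  cycle e (a ++ x :: b' ++ y :: c).
Proof.
have E d : cycle e (a ++ x :: d ++ y :: c) = path e x (rcons d y) && path e y (rcons (c ++ a) x).
  by rewrite -(rot_cycle (size a)) rot_size_cat /= -catA /= -cat_rcons rcons_cat cat_path last_rcons.
by rewrite !E => /andP[_ ->] ->.
Qed.

Lemma splice_uniq a b b' c x y : uniq (a ++ x :: b ++ y :: c) -> uniq b' ->
  {in b', forall z, z \notin a ++ x :: b ++ y :: c} -> uniq (a ++ x :: b' ++ y :: c).
Proof.
have pe (d : seq T) : perm_eq (a ++ x :: d ++ y :: c) (d ++ (a ++ [:: x, y & c])).
  rewrite -cat_rcons perm_catCA perm_cat2l -cats1 -catA perm_cat2l.
  by rewrite -(cat1s x) -[[:: x, y & c]](cat1s x) perm_cat2l.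
rewrite !(perm_uniq (pe _)) => ub ub' nb; rewrite cat_uniq ub'.
move: ub; rewrite cat_uniq => /and3P[_ _ ->]; rewrite andbT.
apply/hasPn=> z zz; apply/negP=> /nb; rewrite (perm_mem (pe b)) mem_cat negb_or zz.
by rewrite andbF.
Qed.
End Walks.

(** * Families of vertex sets and their transversals *)

Section VertexSets.
Variable T : finType.
Variable P : seq T -> Prop.

Definition vertex_sets : {set {set T}} := [set Q | `[< exists2 s, P s & Q = [set x in s] >]].

Lemma vertex_setsP Q : reflect (exists2 s, P s & Q = [set x in s]) (Q \in vertex_sets).
Proof. by rewrite inE; apply: asboolP. Qed.

Lemma mem_vertex_sets s : P s -> [set x in s] \in vertex_sets.
Proof. by move=> Ps; apply/vertex_setsP; exists s. Qed.

Lemma tv_transversal : (forall s, P s -> s != [::]) ->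
  exists2 S : {set T}, #|S| = tv vertex_sets setT & forall s, P s -> exists2 x, x \in S & x \in s.
Proof.
move=> P0; have [S /hitP hS cS] := tv_ex vertex_sets setT; exists S => // s Ps.
have /touchesP[x] : touches [set x in s] S; last by rewrite inE; exists x.
apply: hS; first exact: mem_vertex_sets.
case: s Ps => [/P0//|a s _]; apply/touchesP; exists a; by rewrite !inE ?eqxx.
Qed.

End VertexSets.

(** * Longest paths of a connected graph *)

Section PathInstance.
Variables (G : sgraph) (l : nat).
Local Notation e := (@edge G).
Let e_sym : symmetric e := @edge_sym G.
Hypothesis conn : sg_connected G.
Hypothesis path_le : forall t : seq G, sorted e t -> uniq t -> size t <= l.+1.
Let lp (s : seq G) := [/\ sorted e s, uniq s & size s = l.+1].
Local Notation F := (vertex_sets lp).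

Lemma tight_walk (A B : seq G) a b : a \in A -> b \in B ->
  exists u, link e [set x in A] [set x in B] u /\ tight [set x in A] [set x in B] u.
Proof.
move=> aA bB; have /connectP[p pp lp'] := conn a b.
case/shortenP: pp lp' => p' pp' up' _ lp'.
have [|u [lu tu _]] := @trim _ e [set x in A] [set x in B] (a, p').
  by apply/and4P; split; rewrite //= inE // /lend /= -lp'.
by exists u.
Qed.

(** Otherwise a path joining the two, extended at each end by the longer half of the longest path
    there, would be too long. *)
Lemma longest_paths_meet s s' : lp s -> lp s' -> exists2 x, x \in s & x \in s'.
Proof.
move=> [ss us zs] [ss' us' zs']; apply: contrapT => nm.
have dis z : z \in s -> z \in s' -> False by move=> ? ?; apply: nm; exists z.
have [a as_] : exists a, a \in s by case: s zs {nm ss us dis} => // a s _; exists a; rewrite mem_head.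
have [b bs'] : exists b, b \in s' by case: s' zs' {nm ss' us' dis} => // c s' _; exists c; rewrite mem_head.
have [[x p] [/and4P[/= xs ys pp up] [tA tB]]] := tight_walk as_ bs'.
rewrite !inE /lend /= in xs ys tA tB.
have [h1 [p1 u1 s1 z1]] := half_path e_sym ss us xs.
have [h2 [p2 u2 s2 z2]] := half_path e_sym ss' us' ys.
have p0 : 0 < size p by case: (p) ys => //= ys; case: (dis x).
have zx z : z \in verts (x, p) -> (z \in s -> z = x) /\ (z \in s' -> z = last x p).
  by move=> zp; split=> zs0; [apply: tA | apply: tB]; rewrite ?inE.
have pv z : z \in p -> z \in verts (x, p) by apply: (@mem_behead _ (x :: p)).
have xp : x \notin p by case/andP: up.
have : size (rev (x :: h1) ++ p ++ h2) <= l.+1.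
  apply: path_le.
    have := path_rev e_sym p1; rewrite lastI rev_rcons /= cat_path => ->.
    have -> : last (last x h1) (rev (belast x h1)) = x.
      by case: (h1) => //= c h; rewrite rev_cons last_rcons.
    by rewrite cat_path pp.
  rewrite cat_uniq rev_uniq u1; apply/and3P; split=> //.
    apply/hasPn=> z; rewrite mem_cat /= mem_rev => zz; apply/negP=> /s1 zs0.
    case/orP: zz => [zp|zh].
      by have [h _] := zx z (pv z zp); rewrite -(h zs0) zp in xp.
    by apply: (dis z) => //; apply: s2; rewrite inE zh orbT.
  have [_ up'] := andP up; have [lh uh2] := andP u2.
  rewrite cat_uniq; apply/and3P; split=> //.
  apply/hasPn=> z zh /=; apply/negP=> zp; have [_ h] := zx z (pv z zp).
  by move: lh; rewrite -h ?zh // s2 // inE zh orbT.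
rewrite !size_cat size_rev /=; move: z1 z2 p0; rewrite zs zs'; size_lia.
Qed.

Lemma path_rigid s : lp s -> rigid e s.
Proof.
move=> [ss us zs]; split=> // x y d xs ys ixy pd ud nd.
have [a [b [c [es ix iy]]]] := split_two us ys ixy.
have : size (a ++ x :: d ++ y :: c) <= size s.
  rewrite zs; apply: path_le; first by apply: (splice (b := b)) pd; rewrite -es.
  by apply: (@splice_uniq _ _ b); rewrite -?es.
by rewrite ix iy es !size_cat /= !size_cat /=; size_lia.
Qed.

Lemma path_family : good_family e F.
Proof.
split.
- move=> _ _ /vertex_setsP[s ls ->] /vertex_setsP[s' ls' ->].
  by have [x xs xs'] := longest_paths_meet ls ls'; apply/touchesP; exists x; rewrite inE.
- move=> _ x y /vertex_setsP[s [ss _ _] ->]; rewrite !inE => xs ys.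
  have [p [pp lp' sp]] := sorted_conn e_sym ss xs ys.
  by exists p; split=> // z /sp; rewrite inE.
- by move=> _ /vertex_setsP[s ls ->]; exists s => //; apply: path_rigid.
Qed.

Lemma path_family_card Q : Q \in F -> #|Q| <= l.+1.
Proof.
case/vertex_setsP=> s [_ us zs] ->; rewrite cardsE -zs; apply: card_size.
Qed.

(* Otherwise let w be the last vertex of L on Q: the longer half of Q ending at w, followed
   by the rest of L ++ M, would be too long. *)
Lemma end_hit (L M : seq G) Q : lp (L ++ M) -> (size L).*2 <= l.+1 -> Q \in F ->
  {in M, forall z, z \notin Q} -> False.
Proof.
move=> lLM zL QF nM; have [F_meet _ _] := path_family.
have /touchesP[w0 w0Q] := F_meet _ _ QF (mem_vertex_sets lLM).
rewrite inE mem_cat => /orP[w0L|/nM]; last by rewrite w0Q.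
have [sLM uLM zLM] := lLM; case/vertex_setsP: QF => q [sq uq zq] eQ.
have [u [v eL]] : exists u v, L = u :: v by case: (L) w0L => // u v _; exists u, v.
have [|p1 [p2 [ev wQ nQ]]] := @last_hit _ Q u v.
  by apply/has_setP; exists w0; rewrite // -eL.
set w := last u p1 in wQ.
have wq : w \in q by move: wQ; rewrite eQ inE.
have [h [ph uh sh zh]] := half_path e_sym sq uq wq.
have eLM : L ++ M = belast u p1 ++ w :: (p2 ++ M).
  by rewrite eL ev -cat_rcons -lastI /= -catA.
have nh : {in p2 ++ M, forall z, z \notin q}.
  move=> z; rewrite mem_cat => /orP[zp|/nM]; last by rewrite eQ inE.
  by apply: contra nQ => zq'; apply/has_setP; exists z; rewrite // eQ inE.
have : size (rev (w :: h) ++ p2 ++ M) <= l.+1.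
  apply: path_le.
    have := path_rev e_sym ph; rewrite lastI rev_rcons /= cat_path => ->.
    have -> : last (last w h) (rev (belast w h)) = w.
      by case: (h) => //= c h'; rewrite rev_cons last_rcons.
    by move: sLM; rewrite eLM => /cat_sorted2[].
  rewrite cat_uniq rev_uniq uh; apply/and3P; split=> //.
    apply/hasPn=> z zp; rewrite /= mem_rev; apply/negP=> /sh.
    by apply/negP/nh.
  by move: uLM; rewrite eLM cat_uniq => /and3P[_ _ /andP[]].
move: zLM; rewrite eLM !size_cat size_rev size_belast /= !size_cat.
move: zL; rewrite eL ev /= size_cat; move: zh; rewrite zq; size_lia.
Qed.

Lemma path_rev_lp s : lp s -> lp (rev s).
Proof.
by case=> ss us zs; split; rewrite ?rev_uniq ?size_rev //; apply: sorted_rev.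
Qed.

Local Notation k := (tv F setT).

(** I is a segment of the second half of weight [uphalf k], less than k, so some Q misses it. The
    pieces L and R around I are at most halves of s, so by [end_hit] Q meets both, and Q contains a
    link from L to R that closes up to a cycle through I. *)
Lemma half_cycle s : 1 < k -> lp s -> uphalf k <= tv F [set x in drop (l./2) s] ->
  exists2 c, simple_cycle e c & k <= (tv F [set x in c]).*2.
Proof.
move=> k1 ls tB; have [p tI] := take_of_weight tB.
set L := take (l./2) s; set I := take p (drop (l./2) s) in tI; set R := drop p (drop (l./2) s).
have es : s = L ++ I ++ R by rewrite !cat_take_drop.
have [ss us zs] := ls.
have I0 : 0 < size I.
  by apply: leq_trans (tvs_size F I); rewrite tI; move: k1; clear; lia.
have zL : size L = l./2 by rewrite size_take zs; case: ltnP => //; lia.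
have gF := path_family; have [F_meet F_conn _] := gF.
have [|Q [QF _ _ QI]] := @avoid _ F set0 setT [set x in I].
  by rewrite cards0 add0n tI; move: k1; clear; lia.
have nI z : z \in I -> z \notin Q.
  by move=> zI; apply: contra QI => zQ; apply/touchesP; exists z; rewrite ?inE.
have zR : size L + size I + size R = l.+1 by rewrite -zs es !size_cat addnA.
have [a aL aQ] : exists2 a, a \in L & a \in Q.
  apply: contrapT => nex; apply: (@end_hit (rev R) (rev I ++ rev L) Q) => //.
  - by rewrite -!rev_cat -catA -es; apply: path_rev_lp.
  - by rewrite size_rev; move: zL I0 zR; size_lia.
  - move=> z; rewrite mem_cat !mem_rev => /orP[/nI//|zl].
    by apply/negP=> zQ; apply: nex; exists z.
have [b bR bQ] : exists2 b, b \in R & b \in Q.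
  apply: contrapT => nex; apply: (@end_hit L (I ++ R) Q) => //.
  - by rewrite -es.
  - by move: zL; size_lia.
  - move=> z; rewrite mem_cat => /orP[/nI//|zl].
    by apply/negP=> zQ; apply: nex; exists z.
have [p0 [pp lp0 sp]] := F_conn _ _ _ QF aQ bQ.
case/shortenP: pp lp0 => p' pp' up' sp' lp'.
have [|u [lu tu su]] := @trim _ e [set x in L] [set x in R] (a, p').
  by apply/and4P; split; rewrite //= inE // /lend /= lp'.
have [|||_ [c [sc Ic _]]] := close_link e_sym I0 _ _ lu tu.
- by rewrite -es.
- by rewrite -es.
- move=> z /(mem_subseq su) zu; rewrite inE; apply/negP=> /nI/negP[]; apply: sp.
  move: zu; rewrite inE => /predU1P[->|/sp' zp]; first exact: mem_head.
  by rewrite inE zp orbT.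
exists c => //; have := tvs_sub F Ic; rewrite tI; move: (tv F [set x in c]) k; clear; lia.
Qed.

Lemma path_cycle s : 1 < k -> lp s -> exists2 c, simple_cycle e c & k <= (tv F [set x in c]).*2.
Proof.
move=> k1 ls; have [ss us zs] := ls.
have [tB|tB] := leqP (uphalf k) (tv F [set x in drop (l./2) s]); first exact: half_cycle tB.
apply: (half_cycle k1 (path_rev_lp ls)); rewrite drop_rev zs.
have gF := path_family; have ts := tv_mem gF (mem_vertex_sets ls).
have := tvs_cat F (take (l./2) s) (drop (l./2) s); rewrite cat_take_drop ts => kle.
have : tv F [set x in take (l./2) s] <= tv F [set x in rev (take (l.+1 - l./2) s)].
  apply: tvs_sub => z; rewrite mem_rev => zt.
  by apply: (@mem_take (l./2)); rewrite take_takel //; lia.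
move: tB kle; move: (tv F _) (tv F _) (tv F _) k; clear; lia.
Qed.

End PathInstance.

(** * Longest cycles of a 2-connected graph *)

Section CycleInstance.
Variables (G : sgraph) (n : nat).
Local Notation e := (@edge G).
Let e_sym : symmetric e := @edge_sym G.
Hypothesis G2 : two_connected G.
Let lc (s : seq G) := simple_cycle e s /\ size s = n.
Hypothesis cycle_le : forall t : seq G, simple_cycle e t -> size t <= n.
Local Notation F := (vertex_sets lc).

Lemma walk_avoiding (A B : {set G}) (S : {set G}) : #|S| < 2 -> 2 <= #|A| -> 2 <= #|B| ->
  ~ sep e A B S.
Proof.
case: G2 => _ conn conn1 S1 A2 B2 sS.
have pickA (C : {set G}) : 2 <= #|C| -> exists2 a, a \in C & a \notin S.
  move=> C2; have : 0 < #|C :\: S|.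
    by rewrite cardsD subn_gt0; apply: leq_ltn_trans (leq_trans S1 C2); rewrite subset_leq_card ?subsetIr.
  by case/card_gt0P=> a; rewrite inE => /andP[]; exists a.
have [a aA aS] := pickA A A2; have [b bB bS] := pickA B B2.
have [S0|/set0Pn[v vS]] := eqVneq S set0.
  have /connectP[p pp lp] := conn a b.
  have lB : last a p \in B by rewrite -lp.
  by have /has_setP[z _] := sS a p aA pp lB; rewrite S0 inE.
have eS : S = [set v].
  apply/esym/eqP; rewrite eqEcard sub1set vS cards1; by case: #|S| S1 => [|[]].
have av : a != v by apply: contraNneq aS => ->.
have bv : b != v by apply: contraNneq bS => ->.
have /connectP[p pp lp] := conn1 v (exist _ a av) (exist _ b bv).
have pp' : path e a (map val p).
  by rewrite -[a]/(val (exist (fun x => x != v) a av)) path_map.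
have lB : last a (map val p) \in B.
  by rewrite -[a]/(val (exist (fun x => x != v) a av)) last_map -lp.
have /has_setP[z] := sS a (map val p) aA pp' lB.
rewrite eS !inE => /predU1P[->|/mapP[[w wv] _ ->]]; [exact/negP | exact/negP].
Qed.

(** Two disjoint longest cycles would be joined by two disjoint links. These have at least four
    vertices, and the longer arcs add n - 2 more inner vertices, giving a cycle with more than n. *)
Lemma longest_cycles_meet c d : lc c -> lc d -> exists2 x, x \in c & x \in d.
Proof.
move=> [scc zc] [scd zd]; apply: contrapT => nm.
have /and3P[zc3 cc uc] := scc; have /and3P[zd3 cd ud] := scd.
have dis : {in c, forall z, z \notin d} by move=> z zcc; apply/negP=> zdd; apply: nm; exists z.
have card (s : seq G) : uniq s -> #|[set x in s]| = size s.
  by move=> us; rewrite cardsE; apply/card_uniqP.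
have [S sS|ls0 [zls0 al0 dl0]] := @menger _ e [set x in c] [set x in d] 2.
  rewrite leqNgt; apply/negP=> S2; apply: (@walk_avoiding [set x in c] [set x in d] S) => //.
    by rewrite card // (leq_trans _ zc3).
  by rewrite card // (leq_trans _ zd3).
have [ls [zls al dl tl]] := trim_all al0 dl0.
have [u [v els]] : exists u v, ls = [:: u; v].
  by move: zls; rewrite zls0; case: (ls) => [|u [|v [|]]] //; exists u, v.
have dirP w : w \in ls -> direct e c d w.
  move=> wls; have /and4P[+ + pw uw] := allP al w wls; rewrite !inE => wc wd.
  have [tA tB] := tl w wls; split=> // z zw.
  by split=> zX; [apply: tA | apply: tB]; rewrite ?inE.
have [uls vls] : u \in ls /\ v \in ls by rewrite els !inE !eqxx orbT.
have uv : {in verts u, forall z, z \notin verts v}.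
  move=> z zu; apply/negP=> zv; have := disj_uniq dl.
  by rewrite els /= inE (disj_inj dl uls vls zu zv) eqxx.
have [du dv] := (dirP u uls, dirP v vls); have [n1 n2] := disjoint_ends uv.
have [[_ _ uc1 ud1 _] [_ _ vc1 vd1 _]] := (du, dv).
have [mA [pA umA sA [xA yA] zA]] := long_arc e_sym uc cc uc1 vc1 n1.
have [mB [pB umB sB [xB yB] zB]] := long_arc e_sym ud cd vd1 ud1 n2.
have := cycle_le (join_cycles e_sym dis du dv uv pA umA sA xA yA pB umB sB yB xB).
have sz2 w : w \in ls -> 1 < size (verts w).
  move=> wls; have [_ _ wc wd _] := dirP w wls.
  have : w.2 <> [::] by move=> w2; have := dis _ wc; move: wd; rewrite /lend w2 /= => ->.
  by rewrite /verts /=; case: (w.2).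
rewrite !size_cat size_rev; move: (sz2 u uls) (sz2 v vls) zA zB; rewrite zc zd; size_lia.
Qed.

Lemma cycle_rigid s : lc s -> rigid e s.
Proof.
move=> [sc zs]; have /and3P[z3 cs us] := sc; split=> // x y d xs ys ixy pd ud nd.
(* The empty detour is immediate; otherwise x, y and d provide the three vertices of a cycle. *)
have [->|d0] := eqVneq d [::]; first by [].
have [a [b [c [es ix iy]]]] := split_two us ys ixy.
have : size (a ++ x :: d ++ y :: c) <= size s.
  rewrite zs; apply: cycle_le; apply/and3P; split.
  - rewrite size_cat /= size_cat /=; case: (d) d0 => // d1 d' _ /=; size_lia.
  - by apply: (splice_cycle (b := b)) pd; rewrite -es.
  - by apply: (@splice_uniq _ _ b); rewrite -?es.
by rewrite ix iy es !size_cat /= !size_cat /=; size_lia.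
Qed.

Lemma cycle_family : good_family e F.
Proof.
split.
- move=> _ _ /vertex_setsP[s ls ->] /vertex_setsP[s' ls' ->].
  by have [x xs xs'] := longest_cycles_meet ls ls'; apply/touchesP; exists x; rewrite inE.
- move=> _ x y /vertex_setsP[s [sc _] ->]; rewrite !inE => xs ys.
  have ss : sorted e s.
    by case/and3P: sc => _; case: (s) => //= a s'; rewrite rcons_path => /andP[].
  have [p [pp lp' sp]] := sorted_conn e_sym ss xs ys.
  by exists p; split=> // z /sp; rewrite inE.
- by move=> _ /vertex_setsP[s ls ->]; exists s => //; apply: cycle_rigid.
Qed.

End CycleInstance.

(** * From transversal weights to [lpt] and [lct] *)

Section Transversals.
Variable G : sgraph.
Local Notation e := (@edge G).

Lemma longest_path_lp l (s : seq G) : is_max_path_length G l -> longest_path s ->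
  [/\ sorted e s, uniq s & size s = l.+1].
Proof.
move=> [s0 [ps0 max0] <-] [ps maxs]; have /and3P[s0' ss us] := ps; split=> //.
have := max0 _ ps; have := maxs _ ps0; rewrite /path_length.
by case/and3P: ps0 => + _ _; move: s0'; rewrite -!size_eq0; size_lia.
Qed.

Lemma longest_cycle_lc (c d : seq G) : longest_cycle c -> longest_cycle d -> size d = size c.
Proof.
by move=> [cc maxc] [cd maxd]; apply/eqP; rewrite eqn_leq (maxc _ cd) (maxd _ cc).
Qed.

Lemma max_path_length_bound l (t : seq G) : is_max_path_length G l ->
  sorted e t -> uniq t -> size t <= l.+1.
Proof.
move=> [s0 [_ max0] <-] st ut; case: t st ut => // x t st ut.
by rewrite ltnS; apply: (max0 (x :: t)); apply/and3P.
Qed.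

Lemma max_path_length_gt0 l : 1 < #|G| -> sg_connected G -> is_max_path_length G l -> 0 < l.
Proof.
move=> G2 conn ml; have /card_gt0P[x _] : 0 < #|G| by apply: ltnW.
have /card_gt0P[y] : 0 < #|predC (pred1 x)|.
  by move: G2; rewrite -(cardC (pred1 x)) card1.
rewrite !inE => yx; have /connectP[[|z p]] := conn x y; first by move=> _ /= eyx; rewrite eyx eqxx in yx.
case/andP=> xz _ _; rewrite -ltnS; apply: (@max_path_length_bound l [:: x; z] ml); rewrite /= ?xz //.
by rewrite inE andbT; apply: contraTneq xz => <-; rewrite edge_irrefl.
Qed.

Lemma lpt_leq (S : {set G}) : longest_path_transversal S -> lpt G <= #|S|.
Proof.
move=> tS; rewrite /lpt; case: arg_minnP => [|S0 _ min]; last by apply/min/asboolP.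
apply/asboolP=> s [/and3P[s0 _ _] _]; case: s s0 => // x s _.
by exists x; rewrite ?inE ?eqxx.
Qed.

Lemma lct_leq (S : {set G}) : longest_cycle_transversal S -> lct G <= #|S|.
Proof.
move=> tS; rewrite /lct; case: arg_minnP => [|S0 _ min]; last by apply/min/asboolP.
apply/asboolP=> s [/and3P[s0 _ _] _]; case: s s0 => // x s _.
by exists x; rewrite ?inE ?eqxx.
Qed.

Lemma lpt_square (R : rcfType) l : 1 < #|G| -> sg_connected G -> is_max_path_length G l ->
  [/\ 0 < l, lpt G * lpt G <= 8 * #|G| & lpt G * lpt G <= 1089 * l].
Proof.
move=> G2 conn ml; have l0 := max_path_length_gt0 G2 conn ml.
have pl := fun t => @max_path_length_bound l t ml.
pose lp (s : seq G) := [/\ sorted e s, uniq s & size s = l.+1].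
pose F := vertex_sets lp; have gF : good_family e F := path_family conn pl.
have [s0 ls0 _] := ml; have lps0 : lp s0 := longest_path_lp ml ls0.
have [S cS hS] := @tv_transversal _ lp (fun s ls => ltac:(by case: ls; case: s)).
have lk : lpt G <= tv F setT.
  rewrite -cS; apply: lpt_leq => s ls; apply: hS; exact: longest_path_lp ls.
split=> //; apply: leq_trans (leq_mul lk lk) _.
  (* [path_cycle] asks for weight above 1; for smaller weight the bound is immediate. *)
  have [k1|k1] := leqP (tv F setT) 1.
    by apply: leq_trans (leq_mul k1 k1) _; move: G2; clear; lia.
  exact: tv_square_le_order (@edge_sym G) gF (path_cycle conn pl k1 lps0).
have [ss us zs] := lps0.
apply: (@tv_square_le_length _ e F R (@edge_sym G) gF s0 l l0 us ss (mem_vertex_sets lps0)).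
- by rewrite zs.
- exact: path_family_card.
- move=> c /and3P[_ cc uc]; apply: pl => //.
  by case: (c) cc => //= x p; rewrite rcons_path => /andP[].
Qed.

Lemma lct_square : two_connected G -> lct G * lct G <= 8 * #|G|.
Proof.
move=> G2; have [[c lc]|nex] := pselect (exists c : seq G, longest_cycle c); last first.
  have : lct G <= #|@set0 G| by apply: lct_leq => c lc; case: nex; exists c.
  by rewrite cards0 leqn0 => /eqP->.
pose Lc (s : seq G) := simple_cycle e s /\ size s = size c.
have scP s : longest_cycle s -> Lc s.
  by move=> ls; split; [case: ls | apply: longest_cycle_lc ls].
have lec t : simple_cycle e t -> size t <= size c by case: lc => _ h; apply: h.
pose F := vertex_sets Lc; have gF : good_family e F := cycle_family G2 lec.
have [S cS hS] := @tv_transversal _ Lc (fun s ls => ltac:(by case: ls => /and3P[]; case: s)).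
have lk : lct G <= tv F setT.
  by rewrite -cS; apply: lct_leq => s ls; apply/hS/scP.
apply: leq_trans (leq_mul lk lk) _; apply: (tv_square_le_order (@edge_sym G) gF).
have [sc _] := scP c lc; exists c => //.
by rewrite (tv_mem gF (mem_vertex_sets (scP c lc))) -addnn leq_addr.
Qed.

End Transversals.

(** * The bounds over the reals *)

Import Order.TTheory GRing.Theory Num.Theory.

Local Open Scope ring_scope.

Lemma le_sqrt_nat (R : rcfType) (k m : nat) : (k * k <= m)%N -> k%:R <= Num.sqrt m%:R :> R.
Proof.
move=> km; rewrite -(ger0_norm (ler0n R k)) -sqrtr_sqr ler_wsqrtr //.
by rewrite expr2 -natrM ler_nat.
Qed.

Theorem theorem1 (R : realType) :
  (forall (G : sgraph) (n l : nat),
      #|G| = n -> (2 <= n)%N -> sg_connected G -> is_max_path_length G l ->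
      (lpt G)%:R <= Num.min (Num.sqrt (8 * n%:R)) (33 * l%:R `^ (5 / 9)) :> R)
  /\
  (forall (G : sgraph) (n : nat),
      #|G| = n -> two_connected G ->
      (lct G)%:R <= Num.sqrt (8 * n%:R) :> R).
Proof.
split=> [G n l <- G2 conn ml|G n <- G2]; last first.
  by rewrite -natrM; apply/le_sqrt_nat/lct_square.
have [l0 kn kl] := lpt_square R G2 conn ml.
rewrite le_min -natrM le_sqrt_nat //=; apply: le_trans (le_sqrt_nat R kl) _.
(* sqrt (1089 l) = 33 sqrt l, and sqrt l <= l^(5/9) because l >= 1 and 1/2 <= 5/9. *)
rewrite natrM sqrtrM // (_ : 1089 = 33 ^+ 2) ?sqrtr_sqr ?ger0_norm //; last first.
  by rewrite -natrX.
rewrite ler_pM2l // -powR12_sqrt // ler_powR ?ler1n //; lra.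
Qed.
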